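(* Let $(X_\infty,\mu_\infty)$ be the inverse limit metric measure space constructed in the context. At $\mu_\infty$-a.e. $p_\infty\in X_\infty$ there is a tangent/blow-up of $X_\infty$ which is not topologically connected.
   Context: **Diamonds.** For each integer $n\ge 26$ fix $N=N(n)\in\mathbb N$ with $2N+1$ divisible by $3$ and $\frac1{2N+1}\in[\frac1{128n},\frac1{32n}]$. Let $Q$ be a cube isometric to $[0,\sigma]^3$, $\sigma=\mathrm{slen}(Q)$, and let $K_Q\subset Q$ be the concentric closed subcube of side $\sigma/3$. As a set, $\mathrm{Dym}_n(Q)$ is obtained from $Q$ by replacing $K_Q$ with two copies, $K_{\rm green}$ and $K_{\rm red}$, glued along $\partial K_Q$; $\pi_Q:\mathrm{Dym}_n(Q)\to Q$ is the map collapsing the two copies together. Subdivide $Q$ into $(2N+1)^3$ equal cubes (compatible with $K_Q$) and lift this to a cube-complex structure on $\mathrm{Dym}_n(Q)$ for which $\pi_Q$ is cellular. The subcube with the same center as $Q$ has two lifts $G_{\rm green}(Q)\subset K_{\rm green}$, $G_{\rm red}(Q)\subset K_{\rm red}$, called the gates of $Q$; their centers $c_{\rm green},c_{\rm red}$ form the jump pair $\mathrm{Jpp}(Q)=\{(c_{\rm green},c_{\rm red})\}$. **The inverse system.** Fix an integer $n_0\ge100$; put $n_k=n_0+k$, $\bar n_0=0$, $\bar n_k=\sum_{j=1}^k n_j^3$. Let $X_0=[0,1]^3$ with Euclidean metric, $\mu_0$ Lebesgue measure, $\mathrm{Cell}(X_0)=\{X_0\}$. Inductively let $k\ge0$, $\bar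 n_k\le l<\bar n_{k+1}$, and let $X_l$ be given with metric $d_{X_l}$, measure $\mu_l$, a set $\mathrm{Cell}(X_l)$ of cubical cells of common side length $\mathrm{slen}(X_l)$ and a subset $\mathrm{Gates}(X_l)\subset\mathrm{Cell}(X_l)$. Set $\mathrm{ToDouble}(X_l)=\mathrm{Cell}(X_l)$ if $l=\bar n_k$ and $\mathrm{ToDouble}(X_l)=\mathrm{Cell}(X_l)\setminus\mathrm{Gates}(X_l)$ if $l>\bar n_k$. Then: - $X_{l+1}$ is obtained by replacing each $Q\in\mathrm{ToDouble}(X_l)$ with $\mathrm{Dym}_{n_{k+1}}(Q)$ and subdividing each other cell into $(2N(n_{k+1})+1)^3$ equal cubes; $\mathrm{Cell}(X_{l+1})$ is the set of the resulting small cubes. $\pi_{l+1,l}:X_{l+1}\to X_l$ is $\pi_Q$ on each $\mathrm{Dym}_{n_{k+1}}(Q)$ and the identity on the other cells. - $\mathrm{Gates}(X_{l+1})$ consists of all $G_{\rm green}(Q),G_{\rm red}(Q)$ for $Q\in\mathrm{ToDouble}(X_l)$ together with, when $l>\bar n_k$, all cells of $X_{l+1}$ contained in (the subdivided) cells of $\mathrm{Gates}(X_l)$. - A cover sheet of $X_{l+1}$ is a lift of $X_l$ obtained by choosing, independently for each $Q\in\mathrm{ToDouble}(X_l)$, either the green or the red copy of $K_Q$. Let $\varrho(p,q)=d_{X_l}(\pi_{l+1,l}(p),\pi_{l+1,l}(q))$ if $p,q$ lie in a common cover sheet; $\varrho(p,q)=\frac{1}{4n_{k+1}}\mathrm{slen}(Q)$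 if $\{p,q\}$ is the jump pair of some $Q\in\mathrm{ToDouble}(X_l)$; $\varrho(p,q)=+\infty$ otherwise. Then $d_{X_{l+1}}(p,q)=\inf\sum_{i=0}^{M-1}\varrho(p_i,p_{i+1})$ over all finite chains $p=p_0,\dots,p_M=q$. - $\mu_{l+1}$ satisfies $\pi_{l+1,l\#}\mu_{l+1}=\mu_l$ and is obtained by giving each of the two copies of $K_Q$ half of $\mu_l\llcorner K_Q$, for every $Q\in\mathrm{ToDouble}(X_l)$. The maps $\pi_{l+1,l}$ are surjective and $1$-Lipschitz. $X_\infty$ is the set of sequences $(x_l)_{l\ge0}$ with $x_l\in X_l$ and $\pi_{l+1,l}(x_{l+1})=x_l$, with metric $d_{X_\infty}(x,y)=\limsup_l d_{X_l}(x_l,y_l)$; $\pi_{\infty,l}(x)=x_l$; $\mu_\infty$ is the Radon probability measure on $X_\infty$ with $\pi_{\infty,l\#}\mu_\infty=\mu_l$ for all $l$. **Tangents.** A tangent/blow-up of a metric space $X$ at $p$ is a pointed metric space $(Y,q)$ which is the pointed Gromov–Hausdorff limit of $(X,\frac1{r_n}d_X,p)$ for some sequence $r_n\searrow0$. *)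

(* Defs.v *)
From HB Require Import structures.
From mathcomp Require Import all_boot all_order all_algebra.
From mathcomp Require Import all_classical all_reals all_analysis.

Set Implicit Arguments.
Unset Strict Implicit.
Unset Printing Implicit Defensive.

Import Order.TTheory GRing.Theory Num.Theory.
Import numFieldNormedType.Exports.

Local Open Scope classical_set_scope.
Local Open Scope ring_scope.
Local Open Scope ereal_scope.

(* The spaces X_l, l : nat, are realized as follows. A point of X_(l+1) is a
   point x of X_l together with an optional colour, the colour being present
   exactly when x lies in the interior of the core K_Q of some cell Q that is
   doubled at this step. Points of the boundary of K_Q carry no colour: this is
   the gluing of the two copies of K_Q along their boundary. *)

Variant color := Green | Red.

Section Coordinates.
Variable R : realType.

(* An iterated pair rather than a matrix, so that the library's product
   Lebesgue measure applies. *)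
Definition R3 : Type := (R * R * R)%type.

Definition coord (x : R3) (i : 'I_3) : R := nth 0%R [:: x.1.1; x.1.2; x.2] i.

Definition shift (a : R3) (s : R) (u v w : R) : R3 :=
  ((a.1.1 + s * u)%R, (a.1.2 + s * v)%R, (a.2 + s * w)%R).

Definition cbox (a : R3) (s : R) : set R3 :=
  [set x | forall i, (coord a i <= coord x i <= coord a i + s)%R].

Definition obox (a : R3) (s : R) : set R3 :=
  [set x | forall i, (coord a i < coord x i < coord a i + s)%R].

Definition euclid (x y : R3) : R :=
  Num.sqrt (\sum_(i < 3) (coord x i - coord y i) ^+ 2)%R.

Definition lebesgue3 : set R3 -> \bar R :=
  ((@lebesgue_measure R \x @lebesgue_measure R) \x @lebesgue_measure R).

End Coordinates.

Section MetricTopology.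
Variables (R : realType) (T : Type) (d : T -> T -> \bar R).

Definition dopen : set (set T) :=
  [set A | forall x, A x ->
     exists2 e : R, (0 < e)%R & forall y, d x y < e%:E -> A y].

Lemma dopenT : dopen setT.
Proof. by move=> x _; exists 1%R. Qed.

Lemma dopenI : setI_closed dopen.
Proof.
move=> A B oA oB x [/oA[e e0 eA] /oB[f f0 fB]].
exists (Num.min e f); first by rewrite lt_min e0.
move=> y xy; split.
- by apply: eA; apply: (lt_le_trans xy); rewrite lee_fin ge_min lexx.
- by apply: fB; apply: (lt_le_trans xy); rewrite lee_fin ge_min lexx orbT.
Qed.

Lemma dopen_bigU (I : Type) (f : I -> set T) :
  (forall i, dopen (f i)) -> dopen (\bigcup_i f i).
Proof.
by move=> of_ x [i _ /of_[e e0 he]]; exists e => // y /he fy; exists i.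
Qed.

End MetricTopology.

Section Stages.
Variable R : realType.
Local Notation R3 := (R3 R).

(* A cell is recorded together with the corner of its image in [0,1]^3. *)
Record cell (P : Type) := Cell { corner : R3; body : set P }.

(* [pos] is the composed projection X_l -> X_0 = [0,1]^3. It maps every cell Q
   bijectively onto the cube of side [slen] at [corner Q], and so provides the
   identification of Q with [0,slen]^3. *)
Record stage := Stage {
  pts :> Type;
  pos : pts -> R3;
  dist : pts -> pts -> \bar R;
  mu : set pts -> \bar R;
  slen : R;
  cells : set (cell pts);
  gates : set (cell pts) }.

Definition unit_cube : set R3 := cbox (0, 0, 0)%R 1%R.

(* [gates] is never used at l = 0, where all the cells are doubled. *)
Definition stage0 : stage := {|
  pts := {x : R3 | unit_cube x};
  pos := sval;
  dist x y := (euclid (sval x) (sval y))%:E;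
  mu A := @lebesgue3 R (sval @` A);
  slen := 1%R;
  cells := [set Cell (0, 0, 0)%R setT];
  gates := set0 |}.

Section Step.
(* n = n_(k+1), N = N(n_(k+1)); [first] tells whether l = nbar_k *)
Variables (n N : nat) (first : bool) (S : stage).

Definition to_double : set (cell S) :=
  if first then @cells S else @cells S `\` @gates S.

Definition core_corner (Q : cell S) : R3 :=
  shift (corner Q) (slen S / 3)%R 1%R 1%R 1%R.

Definition core_interior (Q : cell S) : set S :=
  body Q `&` @pos S @^-1` obox (core_corner Q) (slen S / 3)%R.

Definition doubled : set S := \bigcup_(Q in to_double) core_interior Q.

Definition step_pts : Type :=
  {p : S * option color | p.2 <> None <-> doubled p.1}.

Definition colour (p : step_pts) : option color := (sval p).2.
Definition step_proj (p : step_pts) : S := (sval p).1.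

(* The subcube of Q with index (i, j, k) in its (2N+1)^3 subdivision, lifted
   to the copy of colour c. When the subcube does not lie in the core of a
   doubled cell it contains no coloured point, and both lifts coincide. *)
Definition subcell_corner (Q : cell S) (i j k : nat) : R3 :=
  shift (corner Q) (slen S / (2 * N + 1)%:R)%R i%:R%R j%:R%R k%:R%R.

Definition subcell (c : color) (Q : cell S) (i j k : nat) : cell step_pts :=
  Cell (subcell_corner Q i j k)
    [set p | [/\ body Q (step_proj p),
      cbox (subcell_corner Q i j k) (slen S / (2 * N + 1)%:R)%R
        (pos (step_proj p)) &
      colour p = None \/ colour p = Some c]].

Definition step_cells : set (cell step_pts) :=
  [set C | exists c Q (i j k : 'I_(2 * N + 1)),
     @cells S Q /\ C = subcell c Q i j k].

Definition new_gates : set (cell step_pts) :=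
  [set C | exists c Q, to_double Q /\ C = subcell c Q N N N].

Definition old_gates : set (cell step_pts) :=
  [set C | step_cells C /\
     exists2 G, @gates S G & body C `<=` step_proj @^-1` body G].

Definition step_gates : set (cell step_pts) :=
  if first then new_gates else new_gates `|` old_gates.

Definition sheet (ch : cell S -> color) : set step_pts :=
  [set p | forall Q, to_double Q -> core_interior Q (step_proj p) ->
     colour p = Some (ch Q)].

Definition common_sheet (p q : step_pts) : Prop :=
  exists ch, sheet ch p /\ sheet ch q.

Definition gate_center (c : color) (Q : cell S) : set step_pts :=
  [set p | [/\ body Q (step_proj p),
    pos (step_proj p) = shift (corner Q) (slen S / 2)%R 1%R 1%R 1%R &
    colour p = Some c]].

Definition jump_pair (p q : step_pts) : Prop :=
  exists2 Q, to_double Q &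
    (gate_center Green Q p /\ gate_center Red Q q) \/
    (gate_center Red Q p /\ gate_center Green Q q).

Definition step_rho (p q : step_pts) : \bar R :=
  if `[< common_sheet p q >] then dist (step_proj p) (step_proj q)
  else if `[< jump_pair p q >] then (slen S / (4 * n)%:R)%:E
  else +oo.

Definition step_dist (p q : step_pts) : \bar R :=
  ereal_inf [set r | exists (M : nat) (c : nat -> step_pts),
    [/\ c 0%N = p, c M = q & r = \sum_(0 <= i < M) step_rho (c i) (c i.+1)]].

Definition lift_pair (c : color) (x : S) : S * option color :=
  (x, if `[< doubled x >] then Some c else None).

Lemma lift_proof c x : (lift_pair c x).2 <> None <-> doubled (lift_pair c x).1.
Proof. by rewrite /=; case: asboolP. Qed.

(* The lift of X_l to the cover sheet on which every choice is the colour c. *)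
Definition lift_sheet (c : color) (x : S) : step_pts :=
  exist (fun p : S * option color => p.2 <> None <-> doubled p.1) _
    (lift_proof c x).

(* Half of [mu] on the all-green and half on the all-red cover sheet: each of
   the two copies of K_Q gets half of the measure of K_Q, and the two halves
   add up where the two sheets agree. *)
Definition step_mu (A : set step_pts) : \bar R :=
  (2^-1 : R)%R%:E * mu (lift_sheet Green @^-1` A) +
  (2^-1 : R)%R%:E * mu (lift_sheet Red @^-1` A).

Definition step : stage := {|
  pts := step_pts;
  pos p := pos (step_proj p);
  dist := step_dist;
  mu := step_mu;
  slen := (slen S / (2 * N + 1)%:R)%R;
  cells := step_cells;
  gates := step_gates |}.

End Step.

End Stages.

Section Tower.
Variables (R : realType) (n0 : nat) (N : nat -> nat).

Definition nk (k : nat) : nat := (n0 + k)%N.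

Definition nbar (k : nat) : nat := (\sum_(1 <= j < k.+1) nk j ^ 3)%N.

(* The k with nbar k <= l < nbar k.+1 (n0 > 0), see [levelP]. *)
Definition level (l : nat) : nat := (\max_(k < l.+1 | nbar k <= l) k)%N.

Lemma leq_nbar k : (0 < n0)%N -> (k <= nbar k)%N.
Proof.
move=> n0_gt0; elim: k => // k IHk.
rewrite /nbar big_nat_recr//=; apply: (leq_ltn_trans IHk).
by rewrite -[ltnLHS]addn0 ltn_add2l expn_gt0 /nk addnS.
Qed.

Lemma levelP l : (0 < n0)%N -> (nbar (level l) <= l < nbar (level l).+1)%N.
Proof.
move=> n0_gt0; apply/andP; split.
  rewrite /level; elim/big_ind: _ => //; first by rewrite /nbar big_geq.
  by move=> a b; rewrite /maxn; case: ifP.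
rewrite ltnNge; apply/negP => h.
have hl : ((level l).+1 < l.+1)%N.
  by rewrite ltnS (leq_trans _ h)// leq_nbar.
have := @leq_bigmax_cond _ (fun k : 'I_l.+1 => nbar k <= l)%N
  (fun k : 'I_l.+1 => val k) (Ordinal hl) h.
by rewrite /= ltnn.
Qed.

Fixpoint X (l : nat) : stage R :=
  if l is l'.+1 then
    let n := nk (level l').+1 in
    step n (N n) (l' == nbar (level l')) (X l')
  else stage0 R.

Definition prj (l : nat) : X l.+1 -> X l := @step_proj _ _ _.

Definition Xinf : Type :=
  {x : forall l, X l | forall l, prj (x l.+1) = x l}.

Definition prj_inf (l : nat) (x : Xinf) : X l := sval x l.

Definition dinf (x y : Xinf) : \bar R :=
  limn_esup (fun l => dist (prj_inf l x) (prj_inf l y)).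

(* A point of Xinf (the all-green lift_sheet of a corner), as required by
   [measurableType]. *)
Lemma corner_in_cube : unit_cube (0, 0, 0 : R)%R.
Proof.
by move=> i; rewrite /coord/=; case: i => [[|[|[|]]]]//= _;
  rewrite lexx add0r ler01.
Qed.

Definition stage0_point : stage0 R := exist (@unit_cube R) _ corner_in_cube.

Fixpoint green_point (l : nat) : X l :=
  match l return X l with
  | 0 => stage0_point
  | l'.+1 => lift_sheet _ Green (green_point l')
  end.

Definition Xinf_point : Xinf :=
  exist (fun x : forall l, X l => forall l, prj (x l.+1) = x l)
    green_point (fun=> erefl).

HB.instance Definition _ := gen_eqMixin Xinf.
HB.instance Definition _ := gen_choiceMixin Xinf.
HB.instance Definition _ := isPointed.Build Xinf Xinf_point.
HB.instance Definition _ := isOpenTopological.Build Xinf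
  (@dopenT _ _ dinf) (@dopenI _ _ dinf) (@dopen_bigU _ _ dinf).

End Tower.

Definition borel (T : ptopologicalType) := g_sigma_algebraType (@open T).

Definition radon (R : realType) (T : ptopologicalType)
    (P : probability (borel T) R) : Prop :=
  forall A : set (borel T), measurable A ->
    P A = ereal_sup [set P K | K in
      [set K : set (borel T) | [/\ measurable K, @compact T K & K `<=` A]]].

Section Tangents.
Variable R : realType.

(* Pointed Gromov-Hausdorff convergence (Burago-Burago-Ivanov, Def. 8.1.1). *)
Definition pGH_limit (T : nat -> Type) (d : forall n, T n -> T n -> \bar R)
    (p : forall n, T n) (Y : metricType R) (q : Y) : Prop :=
  forall r e : R, (0 < r)%R -> (0 < e)%R -> \forall n \near \oo,
    exists f : T n -> Y,
    [/\ f (p n) = q,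
        forall x y, d n (p n) x < r%:E -> d n (p n) y < r%:E ->
          `|(mdist (f x) (f y))%:E - d n x y| < e%:E &
        forall y, (mdist q y < r - e)%R ->
          exists2 x, d n (p n) x < r%:E & (mdist (f x) y < e)%R].

Definition complete_space (Y : uniformType) : Prop :=
  forall F : set_system Y, ProperFilter F -> cauchy F -> exists y : Y, F --> y.

(* Limits are taken in the class of complete spaces, in which they are unique
   up to isometry. Without completeness, any dense subset containing the base
   point would also be a limit, and connectedness would be meaningless. *)
Definition tangent (T : Type) (d : T -> T -> \bar R) (p : T)
    (Y : metricType R) (q : Y) : Prop :=
  complete_space Y /\
  exists r : nat -> R,
    [/\ forall n, (0 < r n)%R,
        forall m n, (m <= n)%N -> (r n <= r m)%R,
        r n @[n --> \oo] --> 0%R &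
        @pGH_limit (fun=> T) (fun n x y => ((r n)^-1)%:E * d x y) (fun=> p) Y q].

End Tangents.

(* Main.v *)
From HB Require Import structures.
Require Import Defs.
From mathcomp Require Import all_boot all_order all_algebra.
From mathcomp Require Import all_classical all_reals all_analysis.
From mathcomp Require Import zify lra ring.

Set Implicit Arguments.
Unset Strict Implicit.
Unset Printing Implicit Defensive.

Import Order.TTheory GRing.Theory Num.Theory.
Import numFieldNormedType.Exports.

Local Open Scope classical_set_scope.
Local Open Scope ring_scope.

Local Notation coord := Defs.coord.
Local Notation shift := Defs.shift.

(** Why the theorem holds. Let Q be a cell of X_l that is doubled, and let s be
    the side of its gates. The two gates are joined by a jump of length at
    least 8 s and at most 32 s, whereas the boundary of the core of Q, where
    the two copies of the core are glued, is farther from the gates than any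
    fixed multiple of s once l is large. Near a point p over a gate of Q, and
    at the scale s, the space thus consists of two pieces, one for each colour,
    at distance at least 8 s from each other ([core_separation],
    [gate_separation]), and both pieces are met within distance 40 s of p
    ([gate_other]). If this happens for infinitely many l, every limit of the
    rescaled spaces splits into two nonempty open pieces.

    A limit exists because the rescaled balls are uniformly precompact: on the
    scale s the limit distance differs little from the distance of X_(l+2)
    ([dinf_le]), and over Q a point of X_(l+2) is given by its position in the
    cube and two colours, points with the same colours being no farther apart
    than in the cube up to a factor ([gate_cover]). The limit is built as an
    ultralimit. The distance of two bounded sequences is the limit of their
    rescaled distances along an ultrafilter, and [completion] turns this
    semimetric into a complete metric space. Precompactness is what makes the
    ultralimit a pointed Gromov-Hausdorff limit along a subsequence
    ([approximable_near], [disconnected_tangent]).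

    The distances of the X_l are infima over chains, and all lower bounds are
    obtained by following a chain while its cost is deducted from a budget
    ([step_dist_ind]). A property carried through the induction on l
    ([cubical]) is that a cell can only be left through its boundary, which
    needs distinct cells to have disjoint interiors.

    It remains to see that almost every point lies over gates for infinitely
    many l. Both gates of Q lie over the central subcube of Q, so that only the
    projection to the unit cube matters. A point that avoids all gates from the
    phase k on stays, at every level, in the cubes that are left when the
    central subcube of every cube is removed ([avoiding_boxes]). Writing M_i for
    the number of subcubes along an edge at level i, their total volume is at
    most 1 / (1 + sum_i M_i^-3) ([kept_volume_le]), and the series diverges
    since a phase with parameter n has n^3 steps, with M_i <= 128 n in each of
    them ([gate_mass_ge]). *)

(** * Completion of a semimetric *)

(** Distinct points at distance 0 are allowed: two sequences may have the same
    ultralimit. They are identified by [completion]. *)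
Record semimetric (R : realType) (I : Type) := SemiMetric {
  semidist :> I -> I -> R;
  semidistxx : forall a, semidist a a = 0;
  semidistC : forall a b, semidist a b = semidist b a;
  semidist_triangle : forall b a c,
    semidist a c <= semidist a b + semidist b c }.

Section Completion.
Variables (R : realType) (I : Type) (D : semimetric R I).

(** The Kuratowski embedding sends a point a to its distance function D a. The
    uniform limits of these functions give at once the quotient by the relation
    of being at distance 0 and its completion. *)
Definition adherent_profile (f : I -> R) : Prop :=
  forall e, 0 < e -> exists a, forall b, `|f b - D a b| <= e.

Record completion := Completion {
  profile :> I -> R;
  profileP : adherent_profile profile }.

Implicit Types f g h : completion.

HB.instance Definition _ := gen_eqMixin completion.
HB.instance Definition _ := gen_choiceMixin completion.

Definition profile_dist f g : R :=
  sup (range (fun b => `|profile f b - profile g b|)).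

Lemma profile_inhabited f : exists a : I, True.
Proof. by have [a _] := profileP f ltr01; exists a. Qed.

Lemma semidist_lip a b c : `|D a c - D b c| <= D a b.
Proof.
have h1 := semidist_triangle D b a c; have h2 := semidist_triangle D a b c.
rewrite (semidistC D b a) in h2; rewrite ler_norml; lra.
Qed.

Lemma profile_dist_ub f g b : `|profile f b - profile g b| <= profile_dist f g.
Proof.
apply: ub_le_sup; last by exists b.
have [a ha] := profileP f ltr01; have [c hc] := profileP g ltr01.
exists (1 + D a c + 1) => _ [{}b _ <-].
have := ha b; have := hc b; have := semidist_lip a c b.
rewrite !ler_norml; lra.
Qed.

Lemma profile_dist_le f g e :
  (forall b, `|profile f b - profile g b| <= e) -> profile_dist f g <= e.
Proof.
move=> h; apply: ge_sup; last by move=> _ [b _ <-].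
by have [a _] := profile_inhabited f; exists `|profile f a - profile g a|, a.
Qed.

Lemma profile_distxx f : profile_dist f f = 0.
Proof.
apply/eqP; rewrite eq_le; apply/andP; split.
  by apply: profile_dist_le => b; rewrite subrr normr0.
have [a _] := profile_inhabited f.
exact: le_trans (normr_ge0 _) (profile_dist_ub f f a).
Qed.

Lemma profile_dist_eq0 f g : profile_dist f g = 0 -> f = g.
Proof.
move=> fg0; have fg : profile f = profile g.
  apply/funext => b; apply/eqP.
  by rewrite -subr_eq0 -normr_le0 -fg0 profile_dist_ub.
by case: f g fg {fg0} => [f pf] [g pg] /= fg; subst g; congr Completion;
  exact: Prop_irrelevance.
Qed.

Lemma profile_distC f g : profile_dist f g = profile_dist g f.
Proof. by congr sup; apply/seteqP; split=> _ [b _ <-]; exists b;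
  rewrite 1?distrC. Qed.

Lemma profile_dist_triangle g f h :
  profile_dist f h <= profile_dist f g + profile_dist g h.
Proof.
apply: profile_dist_le => b.
have := profile_dist_ub f g b; have := profile_dist_ub g h b.
rewrite !ler_norml; lra.
Qed.

HB.instance Definition _ := isMetric.Build R completion
  profile_distxx profile_dist_eq0 profile_distC profile_dist_triangle.

Lemma mdistE f g : mdist f g = profile_dist f g.
Proof. by []. Qed.

Lemma profile_adherent a : adherent_profile (D a).
Proof. by move=> e e0; exists a => b; rewrite subrr normr0 ltW. Qed.

Definition embed (a : I) : completion := Completion (@profile_adherent a).

Lemma mdist_embed a b : mdist (embed a) (embed b) = D a b.
Proof.
rewrite mdistE; apply/eqP; rewrite eq_le; apply/andP; split.
  by apply: profile_dist_le => c; exact: semidist_lip.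
have := profile_dist_ub (embed a) (embed b) b => /=.
by rewrite semidistxx subr0; apply: le_trans; rewrite ler_norm.
Qed.

Lemma embed_dense f e : 0 < e -> exists a, mdist (embed a) f <= e.
Proof.
move=> e0; have [a ha] := profileP f e0; exists a; rewrite mdistE.
by apply: profile_dist_le => b; rewrite distrC; exact: ha.
Qed.

(** A Cauchy filter of profiles converges pointwise because the real line is
    complete, and uniformly because the Cauchy estimate is the same at all
    points. *)
Lemma completion_complete : complete_space completion.
Proof.
move=> F FF /cauchyP cF.
have cFb b : cvg ((fun f : completion => profile f b) @ F).
  apply: cauchy_cvg; apply/cauchy_exP => e e0.
  have [f0 Ff0] := cF _ e0; exists (profile f0 b).
  suff : \forall f \near F, ball (profile f0 b) e (profile f b) by [].
  apply: filterS Ff0 => f; rewrite ballEmdist /= => hf.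
  exact: le_lt_trans (profile_dist_ub f0 f b) hf.
pose l b := lim ((fun f : completion => profile f b) @ F).
have near_l e : 0 < e -> \forall f \near F, forall b, `|profile f b - l b| <= e.
  move=> e0; have e20 : 0 < e / 2 by rewrite divr_gt0.
  have [f0 Ff0] := cF _ e20.
  apply: filterS (Ff0) => f f0f b.
  have h : \forall g \near F, `|profile f b - profile g b| <= e.
    apply: filterS Ff0 => g f0g.
    apply: le_trans (profile_dist_ub f g b) _.
    move: f0f f0g; rewrite !ballEmdist/= => f0f f0g.
    have := metric_triangle f f0 g; rewrite (metric_sym f f0) -mdistE; lra.
  have cl : `|profile f b - profile g b| @[g --> F] --> `|profile f b - l b|.
    apply: cvg_norm; apply: cvgB; [exact: cvg_cst|exact: cFb].
  by rewrite -(cvg_lim _ cl)//; apply: limr_le => //; apply/cvg_ex; eexists;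
    exact: cl.
have al : adherent_profile l.
  move=> e e0; have e20 : 0 < e / 2 by rewrite divr_gt0.
  have [f hf] := filter_ex (near_l _ e20); have [a ha] := profileP f e20.
  exists a => b; have := hf b; have := ha b; rewrite !ler_norml; lra.
exists (Completion al); apply/cvg_ballP => e e0.
have e20 : 0 < e / 2 by rewrite divr_gt0.
apply: filterS (near_l _ e20) => f hf; rewrite ballEmdist/= mdistE profile_distC.
apply: (@le_lt_trans _ _ (e / 2)); last by lra.
exact: profile_dist_le.
Qed.

(** The neighbourhoods of radius e / 3 of the two classes are open, disjoint, and
    cover the completion by density. *)
Lemma completion_disconnected (side : I -> bool) (e : R) :
  0 < e -> (forall a b, side a != side b -> e <= D a b) ->
  (exists a b, side a != side b) -> ~ connected [set: completion].
Proof.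
move=> e0 sep [a0 [b0 ab0]] conn.
pose half (s : bool) := [set f :
  completion | exists2 a, side a = s & mdist (embed a) f < e / 3].
have half_open s : open (half s).
  rewrite openE => f [a sa af]; rewrite /interior; apply/nbhs_ballP.
  exists (e / 3 - mdist (embed a) f) => /=; first by lra.
  move=> g; rewrite ballEmdist/= => fg; exists a => //.
  have := metric_triangle (embed a) f g; lra.
have halfN s : ~` half s = half (~~ s).
  apply/seteqP; split=> f.
    have [|a /= ha] := embed_dense f (e := e / 4); first by lra.
    move=> nf; exists a; last by lra.
    case: (eqVneq (side a) s) => [sa|]; last by case: (side a) s {nf} => [] [].
    by case: nf; exists a => //; lra.
  move=> [a sa af] [b sb bf].
  have ab : side a != side b by rewrite sa sb; case: (s).
  have := sep _ _ ab; rewrite -mdist_embed => eD.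
  have := metric_triangle (embed a) f (embed b); rewrite (metric_sym f); lra.
have embed_half a : half (side a) (embed a).
  by exists a => //; rewrite mdistxx; lra.
have E : half (side a0) = [set: completion].
  apply: conn; first by exists (embed a0).
  - by exists (half (side a0)); rewrite ?setTI.
  - exists (half (side a0)); rewrite ?setTI//.
    by rewrite -openC halfN.
have : (~` half (side a0)) (embed b0).
  rewrite halfN; suff -> : ~~ side a0 = side b0 by exact: embed_half.
  by move: ab0; case: (side a0) (side b0) => [] [].
by apply; rewrite E.
Qed.

End Completion.

(** * Ultralimits of rescaled spaces *)

Lemma ultra_fmap (T U : Type) (F : set_system T) (f : T -> U) :
  UltraFilter F -> UltraFilter (f @ F).
Proof.
move=> FU; split=> [|G GF FG]; first exact: fmap_proper_filter.
rewrite eqEsubset; split=> // A GA.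
have [//|FnA] := in_ultra_setVsetC (f @^-1` A) FU.
have GnA : G (~` A) by apply: FG.
by have [x []] := filter_ex (filterI GA GnA).
Qed.

(** Limits along an ultrafilter replace the extraction of subsequences: they
    exist for all bounded sequences at once. *)
Lemma ultra_bounded_cvg (R : realType) (F : set_system nat) (u : nat ->
  R) (M : R) :
  UltraFilter F -> (forall n, `|u n| <= M) -> cvg (u @ F).
Proof.
move=> FU uM; have cM := @segment_compact R (- M) M.
have fU := ultra_fmap u FU.
move: cM; rewrite compact_ultra => /(_ (u @ F) fU) [|l [_ ul]].
  suff : \forall n \near F, `[- M, M]%classic (u n) by [].
  by near=> n; have := uM n; rewrite /= in_itv/= ler_norml.
by apply/cvg_ex; exists l.
Unshelve. all: by end_near. Qed.

Lemma ultra_pick (F : set_system nat) (K : finType) (g : nat -> K) :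
  UltraFilter F -> exists i, \forall n \near F, g n = i.
Proof.
move=> FU; apply: contrapT => /forallNP h.
have : \forall n \near F, forall i, g n <> i.
  apply: filter_forall => i.
  have [/h//|] := in_ultra_setVsetC [set n | g n = i] FU.
  by [].
by move=> /filter_ex[n /(_ (g n))].
Qed.

Section Blowup.
Variables (R : realType) (T : Type) (d : semimetric R T) (p : T) (s : nat -> R).
Hypothesis s_gt0 : forall n, 0 < s n.

Lemma semidist_ge0 (I : Type) (D : semimetric R I) x y : 0 <= D x y.
Proof.
have := semidist_triangle D y x x; rewrite semidistxx (semidistC D y x); lra.
Qed.

(** Precompactness in the form in which it is used: the fibres of g cover the
    ball of radius m * s n by sets of small diameter, and the number of these
    sets does not depend on n. *)
Definition uniformly_covered := forall m : nat, exists K : finType,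
  \forall n \near \oo, exists g : T -> K, forall x y,
    d p x < m%:R * s n -> d p y < m%:R * s n -> g x = g y ->
    d x y <= s n / m.+1%:R.

(** The points of the ultralimit of the pointed spaces (T, d / s n, p), before
    identification. *)
Record bounded_seq := BoundedSeq {
  bseq :> nat -> T;
  bseq_bound : exists M : R, forall n, d p (bseq n) <= M * s n }.

Variable U : set_system nat.
Context {UU : UltraFilter U}.

Lemma rescaled_cvg (x y : bounded_seq) :
  cvg ((fun n => d (x n) (y n) / s n) @ U).
Proof.
have [M hM] := bseq_bound x; have [M' hM'] := bseq_bound y.
apply: (@ultra_bounded_cvg _ _ _ (M + M')) => n.
rewrite ger0_norm; last by rewrite divr_ge0 ?semidist_ge0// ltW.
rewrite ler_pdivrMr// mulrDl.
apply: le_trans (semidist_triangle d p _ _) _.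
by rewrite (semidistC d _ p) lerD.
Qed.

Definition ultradist (x y : bounded_seq) : R :=
  lim ((fun n => d (x n) (y n) / s n) @ U).

Lemma cvg_ultradist (x y : bounded_seq) :
  d (x n) (y n) / s n @[n --> U] --> ultradist x y.
Proof. exact: rescaled_cvg. Qed.

Lemma ultradistxx x : ultradist x x = 0.
Proof.
rewrite /ultradist (_ : (fun n => _) = fun=> 0); first exact: lim_cst.
by apply/funext => n; rewrite semidistxx mul0r.
Qed.

Lemma ultradistC x y : ultradist x y = ultradist y x.
Proof. by congr (lim (_ @ U)); apply/funext => n; rewrite semidistC. Qed.

Lemma ultradist_triangle y x z :
  ultradist x z <= ultradist x y + ultradist y z.
Proof.
have c : (d (x n) (y n) / s n + d (y n) (z n) / s n) @[n --> U] -->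
    ultradist x y + ultradist y z by apply: cvgD; exact: cvg_ultradist.
rewrite -(cvg_lim _ c)//; apply: ler_lim; first exact: rescaled_cvg.
- by apply/cvg_ex; eexists; exact: c.
- near=> n; rewrite -mulrDl ler_pM2r ?invr_gt0//.
  exact: semidist_triangle.
Unshelve. all: by end_near. Qed.

Definition ultrametric := SemiMetric ultradistxx ultradistC ultradist_triangle.

Lemma ultradist_near (x y : bounded_seq) e : 0 < e ->
  \forall n \near U, `|d (x n) (y n) / s n - ultradist x y| < e.
Proof.
move=> e0; have /cvgrPdist_lt/(_ _ e0) := @cvg_ultradist x y.
by apply: filterS => n; rewrite distrC.
Qed.

Lemma const_seq_bound : exists M : R, forall n, d p p <= M * s n.
Proof. by exists 0 => n; rewrite semidistxx mul0r. Qed.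

Definition const_seq : bounded_seq := @BoundedSeq (fun=> p) const_seq_bound.

Definition blowup := completion ultrametric.
Definition blowup_base : blowup := embed ultrametric const_seq.

Hypothesis U_oo : \oo `<=` U.

(** The condition of pointed Gromov-Hausdorff convergence, for one index. *)
Definition approximable (n : nat) (r e : R) (f : T -> blowup) :=
  [/\ f p = blowup_base,
      forall x y, d p x < r * s n -> d p y < r * s n ->
        `|mdist (f x) (f y) - d x y / s n| < e &
      forall y : blowup, mdist blowup_base y < r - e ->
        exists2 x, d p x < r * s n & mdist (f x) y < e].

(** A choice of a point in every fibre of the covering gives finitely many
    sequences z i, whose mutual distances are simultaneously close to their
    ultralimits for almost every n. Sending a point to the sequence chosen in
    its fibre has small distortion, because fibres have small diameter. A point
    of the blow-up is close to some z i: it is close to a sequence x, and the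
    ultrafilter selects one of the finitely many fibres through which x runs. *)
Lemma approximable_near : uniformly_covered -> forall r e, 0 < r -> 0 < e ->
  \forall n \near U, exists f, approximable n r e f.
Proof.
move=> cov r e r0 e0.
pose m := maxn (Num.truncn r).+1 (Num.truncn (8 / e)).+1.
have rm : r < m%:R.
  apply: (lt_le_trans (truncnS_gt r)); by rewrite ler_nat leq_maxl.
have m0 : 0 < m%:R :> R by apply: lt_trans rm.
have em : m.+1%:R^-1 < e / 8.
  rewrite -[X in _ < X]invf_div ltf_pV2 ?posrE ?divr_gt0 ?ltr0n//.
  apply: (lt_le_trans (truncnS_gt (8 / e))).
  by rewrite ler_nat (leq_trans (leq_maxr (Num.truncn r).+1 _)).
have [K] := cov m.
move=> [n0 _ hn0].
have [g hg] : exists g : nat -> T -> K, forall n, (n0 <= n)%N -> forall x y,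
    d p x < m%:R * s n -> d p y < m%:R * s n -> g n x = g n y ->
    d x y <= s n / m.+1%:R.
  have h : forall n, exists g : T -> K, (n0 <= n)%N ->
      forall x y, d p x < m%:R * s n -> d p y < m%:R * s n -> g x = g y ->
      d x y <= s n / m.+1%:R.
    move=> n; have [/hn0[g ?]|nn] := leqP n0 n; first by exists g.
    have [g _] := hn0 _ (leqnn n0); by exists g.
  by exists (fun n => sval (cid (h n))) => n; exact: (svalP (cid (h n))).
(* The point p forms a class of its own, so that it is sent to the base point. *)
pose cl n x : option K := if `[< x = p >] then None else Some (g n x).
have clE n : (n0 <= n)%N -> forall x y, d p x < m%:R * s n ->
    d p y < m%:R * s n -> cl n x = cl n y -> d x y <= s n / m.+1%:R.
  move=> hn x y px py; rewrite /cl; case: asboolP => [->|xp];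
    case: asboolP => [->|yp]//.
    by rewrite semidistxx divr_ge0 ?ltW.
  by move=> [/hg]; apply.
(* Representatives of the classes; empty classes are represented by p. *)
pose inball n i x := d p x < m%:R * s n /\ cl n x = i.
pose net i n :=
  if pselect (exists x, inball n i x) is left h then sval (cid h) else p.
have netP n i x : inball n i x -> inball n i (net i n).
  move=> h; rewrite /net; case: pselect => [h'|[]]; last by exists x.
  exact: (svalP (cid h')).
have net_ball i n : d p (net i n) < m%:R * s n.
  rewrite /net; case: pselect => [h|_]; first by case: (svalP (cid h)).
  by rewrite semidistxx mulr_gt0.
have net_bdd i : exists M : R, forall n, d p (net i n) <= M * s n.
  by exists m%:R => n; exact: ltW.
pose z i := BoundedSeq (net_bdd i).
have netN : net None = fun=> p.
  apply/funext => n; rewrite /net; case: pselect => [h|//].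
  have [_] := svalP (cid h).
  by rewrite /cl; case: asboolP.
have zN : z None = const_seq.
  rewrite /z /const_seq; move: (net_bdd None); rewrite netN => b;
    congr BoundedSeq.
  exact: Prop_irrelevance.
have e80 : 0 < e / 8 by lra.
have nearz : \forall n \near U, forall ij : option K * option K,
    `|d (net ij.1 n) (net ij.2 n) / s n - ultradist (z ij.1) (z ij.2)| < e / 8.
  by apply: filter_forall => -[i j]; exact: (ultradist_near (z i) (z j)).
have nearn0 : \forall n \near U, (n0 <= n)%N.
  by apply: U_oo; exists n0.
near=> n.
have hn : (n0 <= n)%N by near: n.
have hz i j : `|d (net i n) (net j n) / s n - ultradist (z i) (z j)| < e / 8.
  by have /(_ (i, j)) : forall ij : option K * option K,
    `|d (net ij.1 n) (net ij.2 n) / s n - ultradist (z ij.1) (z ij.2)| < e / 8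
    by near: n.
have net_close x : d p x < m%:R * s n -> d x (net (cl n x) n) / s n < e / 8.
  move=> px; have [b1 b2] :
    inball n (cl n x) (net (cl n x) n) by exact: (netP _ _ x).
  apply: le_lt_trans em; rewrite ler_pdivrMr// mulrC.
  exact: clE.
exists (fun x => embed ultrametric (z (cl n x))); split.
- by rewrite (_ : cl n p = None) ?zN// /cl asboolT.
- move=> x y px py; rewrite mdist_embed /=.
  have px' : d p x < m%:R * s n by apply: (lt_trans px); rewrite ltr_pM2r.
  have py' : d p y < m%:R * s n by apply: (lt_trans py); rewrite ltr_pM2r.
  have := net_close _ px'; have := net_close _ py'.
  set x' := net (cl n x) n; set y' := net (cl n y) n => hy hx.
  have := hz (cl n x) (cl n y); rewrite -/x' -/y'.
  have h1 : d x' y' / s n <= d x x' / s n + d x y / s n + d y y' / s n.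
    rewrite -!mulrDl ler_pM2r ?invr_gt0//.
    have := semidist_triangle d x x' y'; have := semidist_triangle d y x y'.
    rewrite (semidistC d x' x); lra.
  have h2 : d x y / s n <= d x x' / s n + d x' y' / s n + d y y' / s n.
    rewrite -!mulrDl ler_pM2r ?invr_gt0//.
    have := semidist_triangle d x' x y; have := semidist_triangle d y' x' y.
    rewrite (semidistC d y' y); lra.
  move: h1 h2 hx hy; rewrite !ltr_norml.
  move: (d x' y' / s n) (d x x' / s n) (d x y / s n) (d y y' / s n) => *; lra.
- move=> y qy; have [x hx] := embed_dense y e80.
  have [i hi] := ultra_pick (fun k => cl k (x k)) UU.
  have xp : ultradist const_seq x < r - e + e / 8.
    rewrite -[ultradist _ _]/(ultrametric const_seq x) -mdist_embed.
    have := metric_triangle (embed ultrametric const_seq) y (embed ultrametric x).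
    rewrite (metric_sym y) -/blowup_base; lra.
  (* For almost every k the points x k and z i k lie in the same class. *)
  have xz : ultradist x (z i) <= e / 8.
    apply: limr_le; first exact: rescaled_cvg.
    near=> k.
    have k1 : cl k (x k) = i by near: k.
    have k2 : (n0 <= k)%N by near: k.
    have k3 : `|d p (x k) / s k - ultradist const_seq x| < e / 8.
      by near: k; exact: (ultradist_near const_seq x).
    have xk : d p (x k) < m%:R * s k.
      rewrite -ltr_pdivrMr//; move: k3; rewrite ltr_norml.
      move: (d p (x k) / s k) => *; lra.
    have [b1 b2] : inball k i (z i k) by apply: (netP _ _ (x k)).
    apply: ltW; apply: le_lt_trans em.
    by rewrite ler_pdivrMr// mulrC; apply: clE => //; rewrite k1.
  have pz : d p (z i n) < r * s n.
    rewrite -ltr_pdivrMr//; have := hz None i; rewrite netN zN.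
    have := ultradist_triangle x const_seq (z i).
    rewrite ltr_norml -[net i n]/(z i n).
    move: (d p (z i n) / s n) => *; lra.
  exists (z i n) => //.
  have pz' : d p (z i n) < m%:R * s n by apply: (lt_trans pz); rewrite ltr_pM2r.
  have := net_close _ pz'; set i' := cl n _ => h1.
  have := hz i' i; rewrite ltr_norml (semidistC d) -[net i n]/(z i n) => h2.
  have := metric_triangle (embed ultrametric (z i')) (embed ultrametric (z i)) y.
  have := metric_triangle (embed ultrametric (z i)) (embed ultrametric x) y.
  rewrite !mdist_embed /= (ultradistC (z i) x).
  move: h1 h2; move: (d _ _ / s n) => *; lra.
Unshelve. all: by end_near. Qed.

End Blowup.

(** * Disconnected tangents *)

(** For almost every n, two sequences on different sides of the ultralimit are on
    different sides of chi, so that their rescaled distance is at least 1. *)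
Lemma blowup_disconnected (R : realType) (T : Type) (d : semimetric R T) (p : T)
    (s : nat -> R) (s_gt0 : forall n, 0 < s n) (U : set_system nat)
    (UU : UltraFilter U) (U_oo : \oo `<=` U) (chi : nat -> T -> bool) (C : R) :
  (forall m : nat, \forall n \near \oo, forall x y,
     d p x < m%:R * s n -> d p y < m%:R * s n -> chi n x != chi n y ->
     s n <= d x y) ->
  (forall n, exists2 x, d p x <= C * s n & chi n x != chi n p) ->
  ~ connected [set: blowup d p s_gt0 (U:=U)].
Proof.
move=> sep other.
pose side (x : bounded_seq d p s) := `[< \forall n \near U, chi n (x n) >].
have sideT x : side x -> \forall n \near U, chi n (x n) by move/asboolP.
have sideF x : ~~ side x -> \forall n \near U, ~~ chi n (x n).
  move/asboolPn => h.
  have [//|] := in_ultra_setVsetC [set n | chi n (x n)] UU.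
  by apply: filterS => n /negP.
have side_neq x y : side x != side y ->
  \forall n \near U, chi n (x n) != chi n (y n).
  case: (boolP (side x)) => sx; case: (boolP (side y)) => sy //= _.
    by apply: filterS2 (sideT _ sx) (sideF _ sy) => n -> /negbTE ->.
  by apply: filterS2 (sideF _ sx) (sideT _ sy) => n /negbTE -> ->.
apply: (@completion_disconnected _ _ _ side 1) => // [x y xy|].
  have [M hM] := bseq_bound x; have [M' hM'] := bseq_bound y.
  pose m := (Num.truncn (Num.max M M')).+1.
  have hm : Num.max M M' < m%:R by exact: truncnS_gt.
  apply: limr_ge; first exact: rescaled_cvg.
  have sepm := U_oo _ (sep m).
  apply: filterS2 (side_neq _ _ xy) sepm => n cn h.
  rewrite ler_pdivlMr// mul1r; apply: h => //.
    apply: le_lt_trans (hM n) _; rewrite ltr_pM2r//.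
    by apply: le_lt_trans hm; rewrite le_max lexx.
  apply: le_lt_trans (hM' n) _; rewrite ltr_pM2r//.
  by apply: le_lt_trans hm; rewrite le_max lexx orbT.
pose w n := sval (cid2 (other n)).
have wP n : d p (w n) <= C * s n /\ chi n (w n) != chi n p.
  by rewrite /w; case: cid2.
have wB : exists M : R, forall n, d p (w n) <= M * s n.
  by exists C => n; have [] := wP n.
exists (BoundedSeq wB), (const_seq d p s); apply/negP => /eqP E.
have [h|h] := boolP (side (const_seq d p s)).
- have h' := h; rewrite -E in h'.
  have [n [/= a b]] := filter_ex (filterI (sideT _ h) (sideT _ h')).
  by have [_] := wP n; rewrite a b.
- have h' := h; rewrite -E in h'.
  have [n [/= a b]] := filter_ex (filterI (sideF _ h) (sideF _ h')).
  by have [_] := wP n; rewrite (negbTE a) (negbTE b).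
Qed.

(** The factor 2 is needed in the last clause: that the point provided for the
    radius r' lies in the ball of radius r follows from its being close to y. *)
Lemma approximable_weaken (R : realType) (T : Type) (d : semimetric R T) (p : T)
    (s : nat -> R) (s_gt0 : forall n, 0 < s n) (U : set_system nat)
    (UU : UltraFilter U) n (r e r' e' : R) (f : T -> blowup d p s_gt0 (U:=U)) :
  0 < e -> r <= r' -> e' <= e / 2 ->
  approximable n r' e' f -> approximable n r e f.
Proof.
move=> e0 rr ee [fp fd fs]; have sn := s_gt0 n.
have up x : d p x < r * s n -> d p x < r' * s n.
  by move=> /lt_le_trans; apply; rewrite ler_pM2r.
split=> //.
  move=> x y /up px /up py; apply: lt_le_trans (fd _ _ px py) _.
  lra.
move=> y qy.
have [|x px fxy] := fs y; first lra.
exists x; last by lra.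
have pp : d p p < r' * s n by apply: le_lt_trans px;
  rewrite semidistxx semidist_ge0.
have := fd _ _ pp px; rewrite fp ltr_norml.
have := metric_triangle (blowup_base d p s_gt0 (U:=U)) y (f x);
  rewrite (metric_sym y).
rewrite -ltr_pdivrMr//; move: (d p x / s n) => *; lra.
Qed.

(** Almost every index admits an approximation of radius j + 1 and precision
    1 / (j + 1). The sets of the ultrafilter are unbounded, so that the indices
    for the successive j can be taken increasing; along them the blow-up is a
    limit in the sense of Gromov and Hausdorff. *)
Theorem disconnected_tangent (R : realType) (T : Type) (delta : T -> T -> \bar R)
    (d : semimetric R T) (p : T) (s : nat -> R) (chi : nat -> T -> bool) (C : R) :
  (forall x y, delta x y = (d x y)%:E) ->
  (forall n, 0 < s n) ->
  (forall m n, (m <= n)%N -> s n <= s m) ->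
  s n @[n --> \oo] --> 0 ->
  uniformly_covered d p s ->
  (forall m : nat, \forall n \near \oo, forall x y,
     d p x < m%:R * s n -> d p y < m%:R * s n -> chi n x != chi n y ->
     s n <= d x y) ->
  (forall n, exists2 x, d p x <= C * s n & chi n x != chi n p) ->
  exists (Y : metricType R) (q : Y), tangent delta p q /\ ~ connected [set: Y].
Proof.
move=> dE s_gt0 s_mono s_cvg cov sep other.
have [U [UU U_oo]] := ultraFilterLemma (eventually_filter : ProperFilter \oo).
exists (blowup d p s_gt0 (U:=U)), (blowup_base d p s_gt0 (U:=U)).
split; last exact: blowup_disconnected sep other.
split; first exact: completion_complete.
have ex j k : exists n, (k <= n)%N /\
    exists f, @approximable _ _ d p s s_gt0 U UU n j.+1%:R j.+1%:R^-1 f.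
  have h1 := approximable_near s_gt0 U_oo cov (ltr0Sn R j) (_ : 0 < j.+1%:R^-1).
  have h2 : \forall n \near U, (k <= n)%N by apply: U_oo; exists k.
  have [|n [a b]] := filter_ex (filterI h2 (h1 UU _)); first by rewrite invr_gt0.
  by exists n.
pose pick j k := sval (cid (ex j k)).
pose phi := fix phi j := if j is i.+1 then pick i.+1 (phi i).+1 else pick 0%N 0%N.
have phiP j : exists f,
    @approximable _ _ d p s s_gt0 U UU (phi j) j.+1%:R j.+1%:R^-1 f.
  by case: j => [|j] /=; rewrite /pick; case: cid => n [].
have phi_lt j : (phi j < phi j.+1)%N.
  by rewrite /= /pick; case: cid => n [].
have phi_homo : {homo phi : m n / (m <= n)%N}.
  apply: homo_leq => //; first exact: leq_trans.
  by move=> i; exact: ltnW.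
have phi_ge j : (j <= phi j)%N.
  by elim: j => // j IH; apply: leq_ltn_trans IH _.
exists (s \o phi); split=> //.
- by move=> n; exact: s_gt0.
- by move=> m n mn; apply/s_mono/phi_homo.
- apply: cvg_comp s_cvg => A [N _ hN]; exists N => // n /= Nn.
  by apply: hN; exact: leq_trans (phi_ge n).
move=> r e r0 e0.
have : \forall j \near \oo, r <= j.+1%:R :> R /\ j.+1%:R^-1 <= e / 2 :> R.
  exists (maxn (Num.truncn r) (Num.truncn (2 / e))) => // j /=.
  rewrite geq_max => /andP[j1 j2]; split.
    apply: ltW; apply: lt_le_trans (truncnS_gt r) _; by rewrite ler_nat.
  rewrite -[leRHS]invf_div lef_pV2 ?posrE ?divr_gt0 ?ltr0n//.
  apply: ltW; apply: lt_le_trans (truncnS_gt _) _; by rewrite ler_nat.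
apply: filterS => j [rj ej]; have [f hf] := phiP j.
have [fp fd fs] := approximable_weaken e0 rj ej hf.
have sj := s_gt0 (phi j).
have dlt x y (t : R) : (((s (phi j))^-1)%:E * delta x y < t%:E)%E =
  (d x y < t * s (phi j)).
  by rewrite dE -EFinM lte_fin mulrC ltr_pdivrMr.
exists f; split=> //.
- move=> x y; rewrite !dlt => px py; rewrite dE -EFinM -EFinB abse_EFin lte_fin.
  by rewrite [_^-1 * _]mulrC; exact: fd.
- by move=> y /fs[x px fy]; exists x => //; rewrite dlt.
Qed.

(** * The distance of one step *)

(** Depth at least t in the cube [cbox a s]. *)
Definition inset (R : realType) (a : R3 R) (s t : R) (z : R3 R) : Prop :=
  forall i, (coord a i + t <= coord z i <= coord a i + s - t)%R.

(** What the induction on the stages carries. By [cell_ball] a cell can only be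
    left through its boundary; by [cell_interior] distinct cells have disjoint
    interiors. The factor 2 in [cell_dist] bounds sqrt 3, the diameter of the
    unit cube. *)
Record cubical (R : realType) (S : stage R) : Prop := {
  slen_gt0 : 0 < slen S;
  dist_ge0 : forall x y : S, (0 <= dist x y)%E;
  dist_fin : forall x y : S, dist x y \is a fin_num;
  distxx : forall x : S, dist x x = 0%E;
  distC : forall x y : S, dist x y = dist y x;
  dist_triangle : forall y x z : S, (dist x z <= dist x y + dist y z)%E;
  pos_lip : forall (x y : S) i,
    ((`|coord (pos x) i - coord (pos y) i|)%:E <= dist x y)%E;
  cell_cover : forall x : S, exists2 Q, @cells _ S Q & body Q x;
  cell_pos : forall Q (x : S), @cells _ S Q -> body Q x ->
    cbox (corner Q) (slen S) (pos x);
  cell_inj : forall Q (x y : S), @cells _ S Q -> body Q x -> body Q y ->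
    pos x = pos y -> x = y;
  cell_surj : forall Q z, @cells _ S Q -> cbox (corner Q) (slen S) z ->
    exists2 x : S, body Q x & pos x = z;
  cell_dist : forall Q (x y : S) t, @cells _ S Q -> body Q x -> body Q y ->
    (forall i, `|coord (pos x) i - coord (pos y) i| <= t) ->
    (dist x y <= (2 * t)%:E)%E;
  cell_ball : forall Q (x y : S) t, @cells _ S Q -> body Q x ->
    inset (corner Q) (slen S) t (pos x) -> (dist x y < t%:E)%E -> body Q y;
  cell_interior : forall Q Q' (x : S), @cells _ S Q -> @cells _ S Q' ->
    body Q x -> body Q' x -> obox (corner Q) (slen S) (pos x) -> Q = Q' }.

Section StepMetric.
Variables (R : realType) (n : nat) (first : bool) (S : stage R).
Hypothesis cS : cubical S.
Local Notation T := (step_pts first S).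
Local Notation rho := (@step_rho R n first S).
Local Notation sdist := (@step_dist R n first S).
Implicit Types x y z p q : T.

Lemma sub_to_double : @to_double R first S `<=` @cells _ S.
Proof. by rewrite /to_double; case: first => Q //= []. Qed.

Lemma common_sheetC p q : common_sheet p q = common_sheet q p.
Proof.
by apply/propext; split=> -[ch [h1 h2]]; exists ch.
Qed.

Lemma jump_pairC p q : jump_pair p q = jump_pair q p.
Proof. by apply/propext; split=> -[Q dQ [[]|[]]] *; exists Q; tauto. Qed.

Lemma jump_cost_ge0 : 0 <= slen S / (4 * n)%:R.
Proof. by rewrite divr_ge0// ltW// (slen_gt0 cS). Qed.

Lemma step_rho_ge0 x y : (0 <= rho x y)%E.
Proof.
rewrite /step_rho; case: ifP => _; first exact: dist_ge0.
by case: ifP => _; rewrite ?lee_fin ?jump_cost_ge0.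
Qed.

Lemma step_rhoC x y : rho x y = rho y x.
Proof.
by rewrite /step_rho common_sheetC jump_pairC (distC cS).
Qed.

Lemma step_dist_ge0 x y : (0 <= sdist x y)%E.
Proof.
apply: le_ereal_inf_tmp => _ [M [c [_ _ ->]]].
by apply: sume_ge0 => i _; exact: step_rho_ge0.
Qed.

Lemma step_dist_le_rho x y : (sdist x y <= rho x y)%E.
Proof.
apply: ereal_inf_lbound; exists 1%N, (fun i => if i is 0%N then x else y).
by rewrite big_nat1.
Qed.

Lemma step_distxx x : sdist x x = 0%E.
Proof.
apply/eqP; rewrite eq_le step_dist_ge0 andbT; apply: ereal_inf_lbound.
by exists 0%N, (fun=> x); rewrite big_nil.
Qed.

Lemma step_dist_le_sym x y : (sdist x y <= sdist y x)%E.
Proof.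
apply: le_ereal_inf_tmp => _ [M [c [cx cy ->]]]; apply: ereal_inf_lbound.
exists M, (fun i => c (M - i)%N); split; rewrite ?subn0 ?subnn//.
rewrite big_nat_rev add0n /=; apply: eq_big_nat => i /andP[_ iM].
by rewrite step_rhoC subnSK.
Qed.

Lemma step_distC x y : sdist x y = sdist y x.
Proof. by apply/eqP; rewrite eq_le !step_dist_le_sym. Qed.

Lemma step_dist_lt_chain x y (r : \bar R) : (sdist x y < r)%E ->
  exists (M : nat) (c : nat -> T),
  [/\ c 0%N = x, c M = y & (\sum_(0 <= i < M) rho (c i) (c i.+1) < r)%E].
Proof. by case/ereal_inf_lt => _ [M [c [c0 cM ->]]] h; exists M, c. Qed.

Lemma step_dist_le_chain (M : nat) (c : nat -> T) :
  (sdist (c 0%N) (c M) <= \sum_(0 <= i < M) rho (c i) (c i.+1))%E.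
Proof. by apply: ereal_inf_lbound; exists M, c. Qed.

Lemma step_dist_triangle y x z : (sdist x z <= sdist x y + sdist y z)%E.
Proof.
have [->|xy] := eqVneq (sdist x y) +oo%E.
  rewrite addye ?leey// -ltNye.
  by apply: lt_le_trans (step_dist_ge0 y z); rewrite ltNy0.
have [->|yz] := eqVneq (sdist y z) +oo%E.
  rewrite addey ?leey// -ltNye.
  by apply: lt_le_trans (step_dist_ge0 x y); rewrite ltNy0.
have fxy : sdist x y \is a fin_num by rewrite ge0_fin_numE ?step_dist_ge0// ltey.
have fyz : sdist y z \is a fin_num by rewrite ge0_fin_numE ?step_dist_ge0// ltey.
apply/lee_addgt0Pr => e e0; have e20 : 0 < e / 2 by rewrite divr_gt0.
have [|M [c [cx cy hc]]] := @step_dist_lt_chain x y (sdist x y + (e / 2)%:E).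
  by rewrite lteDl// lte_fin.
have [|M' [c' [cy' cz hc']]] := @step_dist_lt_chain y z (sdist y z + (e / 2)%:E).
  by rewrite lteDl// lte_fin.
pose b i := if (i <= M)%N then c i else c' (i - M)%N.
have bM i : b (M + i)%N = c' i.
  rewrite /b; case: leqP; last by rewrite addKn.
  rewrite -[leqRHS]addn0 leq_add2l leqn0 => /eqP->.
  by rewrite addn0 cy cy'.
have := step_dist_le_chain (M + M') b.
rewrite bM cz {1}/b leq0n cx => /le_trans; apply.
rewrite (big_cat_nat (n:=M)) ?leq_addr//=.
rewrite [X in (X + _ <= _)%E](_ : _ = \sum_(0 <= i < M) rho (c i) (c i.+1))%E;
  last first.
  by apply: eq_big_nat => i /andP[_ iM]; rewrite /b iM ltnW.
rewrite [X in (_ + X <= _)%E](_ : _ = \sum_(0 <= i < M') rho (c' i) (c' i.+1))%E;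
  last first.
  rewrite -{1}[M]add0n [(M + M')%N]addnC big_addn addnK; apply: eq_big_nat => i _.
  by rewrite -addSn ![(_ + M)%N]addnC !bM.
apply: le_trans (leeD (ltW hc) (ltW hc')) _.
by rewrite addeACA -EFinD -splitr.
Qed.

(** A jump joins two points over the centre of one cell, which the projection
    identifies. *)
Lemma step_rho_proj x y : (dist (step_proj x) (step_proj y) <= rho x y)%E.
Proof.
rewrite /step_rho; case: asboolP => // _; case: asboolP => [|_]; last exact: leey.
move=> [Q /sub_to_double cQ h]; suff -> : step_proj x = step_proj y.
  by rewrite distxx ?lee_fin ?jump_cost_ge0.
by case: h => -[[bx px _] [qx pq _]]; apply: (cell_inj cS cQ) => //;
  rewrite px pq.
Qed.

Lemma step_dist_proj x y : (dist (step_proj x) (step_proj y) <= sdist x y)%E.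
Proof.
apply: le_ereal_inf_tmp => _ [M [c [<- <- ->]]].
elim: M => [|M IH]; first by rewrite big_nil distxx.
rewrite big_nat_recr//=;
  apply: le_trans (dist_triangle cS (step_proj (c M)) _ _) _.
by rewrite leeD// step_rho_proj.
Qed.

Lemma step_pos_lip x y i :
  ((`|coord (pos (step_proj x)) i - coord (pos (step_proj y)) i|)%:E <=
    sdist x y)%E.
Proof. by apply: le_trans (step_dist_proj x y); exact: pos_lip. Qed.

(** All lower bounds for the distance of a step are instances of this induction
    along a chain of cost less than t: the first argument of W is the part of
    the budget t that is not yet spent. *)
Lemma step_dist_ind (W : R -> T -> Prop) (t : R) x y :
  (forall t x y r, W t x -> rho x y = r%:E -> 0 <= r < t -> W (t - r) y) ->
  W t x -> (sdist x y < t%:E)%E -> exists2 t', 0 < t' & W t' y.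
Proof.
move=> step Wx /step_dist_lt_chain[M [c [cx <- hc]]].
pose sum k := (\sum_(0 <= i < k) rho (c i) (c i.+1))%E.
have sum_ge0 k : (0 <= sum k)%E by apply: sume_ge0 => i _; exact: step_rho_ge0.
have sumS k : sum k.+1 = (sum k + rho (c k) (c k.+1))%E.
  by rewrite /sum big_nat_recr.
suff H k : (sum k < t%:E)%E ->
  exists r, [/\ sum k = r%:E, r < t & W (t - r) (c k)].
  by have [r [_ rt Wr]] := H M hc; exists (t - r) => //; rewrite subr_gt0.
elim: k => [|k IH] hk.
  exists 0; rewrite subr0 cx /sum big_nil; split=> //.
  by move: hk; rewrite /sum big_nil lte_fin.
have sk : (sum k < t%:E)%E.
  by apply: le_lt_trans hk; rewrite sumS leeDl// step_rho_ge0.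
have [r [Er rt Wr]] := IH sk.
move: hk; rewrite sumS Er => hk.
have := step_rho_ge0 (c k) (c k.+1).
case E : (rho (c k) (c k.+1)) hk => [u| |]//= hk u0.
rewrite -EFinD lte_fin in hk; rewrite lee_fin in u0.
exists (r + u); split=> //; rewrite opprD addrA.
apply: step Wr E _; lra.
Qed.

(** Both points lie on the sheet that makes the choice c in every cell. *)
Lemma same_colour_sheet c x y :
  (colour x = None \/ colour x = Some c) ->
  (colour y = None \/ colour y = Some c) -> common_sheet x y.
Proof.
move=> hx hy; exists (fun=> c).
have in_sheet z : (colour z = None \/ colour z = Some c) -> sheet (fun=> c) z.
  move=> hz Q dQ Qz; case: hz => // h.
  by have /(_ _)/(_ h)[] := (svalP z).2; exists Q.
by split; exact: in_sheet.
Qed.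

Lemma same_colour_dist c x y :
  (colour x = None \/ colour x = Some c) ->
  (colour y = None \/ colour y = Some c) ->
  (sdist x y <= dist (step_proj x) (step_proj y))%E.
Proof.
move=> hx hy; apply: le_trans (step_dist_le_rho x y) _.
by rewrite /step_rho asboolT//; apply: same_colour_sheet hx hy.
Qed.

Lemma center_in_core Q (z : S) : @cells _ S Q -> body Q z ->
  pos z = shift (corner Q) (slen S / 2) 1 1 1 -> core_interior Q z.
Proof.
move=> cQ Qz pz; split=> //; rewrite /preimage/= pz => i.
have s0 := slen_gt0 cS.
by case: i => [[|[|[|]]]]//= i; rewrite /core_corner /shift /coord/=; lra.
Qed.

Lemma lift_sheet_colour c (z : S) : 
  colour (lift_sheet first c z) = None \/
  colour (lift_sheet first c z) = Some c.
Proof. by rewrite /colour/=; case: asboolP; [right|left]. Qed.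

Lemma lift_sheet_doubled c (z : S) : doubled first z ->
  colour (lift_sheet first c z) = Some c.
Proof. by rewrite /colour/=; case: asboolP. Qed.

(** Go to the centre of Q in the sheet of x, jump if the colour of y requires it,
    and go on in the sheet of y. *)
Lemma through_center Q (z : S) x y : to_double first Q -> body Q z ->
  pos z = shift (corner Q) (slen S / 2) 1 1 1 ->
  (sdist x y <=
   dist (step_proj x) z + (slen S / (4 * n)%:R)%:E + dist z (step_proj y))%E.
Proof.
move=> dQ Qz pz.
have cz : core_interior Q z by apply: center_in_core => //; exact: sub_to_double.
have zd : doubled first z by exists Q.
have J c c' : (sdist (lift_sheet first c z) (lift_sheet first c' z) <=
  (slen S / (4 * n)%:R)%:E)%E.
  have [->|cc'] := pselect (c = c').
    by rewrite step_distxx lee_fin jump_cost_ge0.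
  apply: le_trans (step_dist_le_rho _ _) _.
  rewrite /step_rho; case: asboolP => [_|_].
    by rewrite distxx// lee_fin jump_cost_ge0.
  rewrite asboolT//; exists Q => //.
  by case: c c' cc' => [] []// _; [left|right]; split; split=> //=;
    rewrite lift_sheet_doubled.
have X x0 : exists c, colour x0 = None \/ colour x0 = Some c.
  by case: (colour x0) => [c|]; [exists c; right|exists Green; left].
have [c hc] := X x; have [c' hc'] := X y.
apply: le_trans (step_dist_triangle (lift_sheet first c' z) _ _) _.
apply: leeD; last exact: (same_colour_dist (lift_sheet_colour c' z) hc').
apply: le_trans (step_dist_triangle (lift_sheet first c z) _ _) _.
apply: leeD; last exact: J.
exact: (same_colour_dist hc (lift_sheet_colour c z)).
Qed.

End StepMetric.

(** * Cells of one step *)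

Lemma coord_shift (R : realType) (a : R3 R) (s u v w : R) (r : 'I_3) :
  coord (shift a s u v w) r = coord a r + s * nth 0 [:: u; v; w] r.
Proof. by case: r => [[|[|[|]]]]. Qed.

Lemma subdivision_le (R : realFieldType) (s h : R) (M i : nat) :
  0 < h -> h * M%:R = s -> (i < M)%N -> 0 <= h * i%:R /\ h * i%:R + h <= s.
Proof.
move=> h0 <- iM; split; first by rewrite mulr_ge0// ltW.
by rewrite -[X in _ + X <= _]mulr1 -mulrDr ler_pM2l// natr1 ler_nat.
Qed.

(** The end points of the middle third are division points, hence are not
    interior to any piece. *)
Lemma subdivision_core (R : realFieldType) (s h : R) (M i : nat) :
  0 < h -> h * M%:R = s -> (3 %| M)%N ->
  s / 3 < h * i%:R + h -> h * i%:R < 2 * s / 3 ->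
  s / 3 <= h * i%:R /\ h * i%:R + h <= 2 * s / 3.
Proof.
move=> h0 <- /dvdnP[m ->]; rewrite natrM.
rewrite (_ : h * (m%:R * 3%:R) / 3 = h * m%:R); last by field.
rewrite (_ : 2 * (h * (m%:R * 3%:R)) / 3 = h * (2 * m)%:R);
  last by rewrite natrM; field.
rewrite -[X in _ + X]mulr1 -mulrDr natr1 !ltr_pM2l// !ler_pM2l//.
rewrite !ltr_nat !ler_nat; lia.
Qed.

Lemma subdivision_cover (R : realType) (s h u : R) (M : nat) :
  0 < h -> h * M%:R = s -> 0 <= u <= s -> (0 < M)%N ->
  exists2 i : 'I_M, h * i%:R <= u & u <= h * i%:R + h.
Proof.
move=> h0 <- /andP[u0 us] M0.
have [iM|Mi] := ltnP (Num.truncn (u / h)) M.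
  exists (Ordinal iM) => /=.
    rewrite mulrC -ler_pdivlMr// truncn_le//; first by rewrite divr_ge0// ltW.
  rewrite -[X in _ + X]mulr1 -mulrDr natr1 mulrC -ler_pdivrMr// ltW//.
  exact: truncnS_gt.
have PM : (M.-1 < M)%N by rewrite prednK.
exists (Ordinal PM) => /=; last first.
  by rewrite -[X in _ + X]mulr1 -mulrDr natr1 prednK.
rewrite mulrC -ler_pdivlMr//; apply: (@le_trans _ _ (Num.truncn (u / h))%:R).
  by rewrite ler_nat; lia.
by rewrite truncn_le// divr_ge0// ltW.
Qed.

Lemma subdivision_inj (R : realFieldType) (h u : R) (i i' : nat) : 0 < h ->
  h * i%:R < u -> u < h * i%:R + h -> h * i'%:R <= u -> u <= h * i'%:R + h ->
  i = i'.
Proof.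
move=> h0 u1 u2 u3 u4.
have a : h * i%:R < h * i'.+1%:R by rewrite -natr1 mulrDr mulr1; lra.
have b : h * i'%:R < h * i.+1%:R by rewrite -natr1 mulrDr mulr1; lra.
by move: a b; rewrite !ltr_pM2l// !ltr_nat; lia.
Qed.

Section StepGeometry.
Variables (R : realType) (n N : nat) (first : bool) (S : stage R).
Hypotheses (cS : cubical S) (n_gt0 : (0 < n)%N) (N3 : (3 %| 2 * N + 1)%N).
Hypothesis nN : (32 * n <= 2 * N + 1)%N.
Local Notation T := (step_pts first S).
Local Notation rho := (@step_rho R n first S).
Local Notation sdist := (@step_dist R n first S).
Local Notation M := (2 * N + 1)%N.
Local Notation h := (slen S / (2 * N + 1)%:R).
Implicit Types x y p q : T.

Let h_gt0 : 0 < h.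
Proof. by rewrite divr_gt0 ?ltr0n ?addn1// (slen_gt0 cS). Qed.

Let hM : h * M%:R = slen S.
Proof. by rewrite divfK// pnatr_eq0 addn1. Qed.

(** By the lower bound on N, a jump costs more than the diameter of the gates that
    it joins. *)
Lemma jump_cost_large : 8 * h <= slen S / (4 * n)%:R.
Proof.
move: hM h_gt0; move: h => u <- u0; rewrite ler_pdivlMr ?ltr0n ?muln_gt0//.
by rewrite [8 * _]mulrC -mulrA ler_pM2l// -natrM ler_nat; clear N3; lia.
Qed.

Lemma obox_inset (a : R3 R) s t z : 0 < t -> inset a s t z -> obox a s z.
Proof. by move=> t0 H i; have := H i; lra. Qed.

Lemma core_coord (Q : cell R S) i :
  coord (core_corner Q) i = coord (corner Q) i + slen S / 3.
Proof. by rewrite coord_shift; case: i => [[|[|[|]]]]//= ?; rewrite mulr1. Qed.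

Lemma core_inset_cell (Q : cell R S) t z :
  inset (core_corner Q) (slen S / 3) t z -> inset (corner Q) (slen S) t z.
Proof.
by move=> H i; have := H i; rewrite core_coord; have := slen_gt0 cS; lra.
Qed.

Lemma inset_move (a : R3 R) s t x y r : inset a s t (pos (step_proj x)) ->
  (dist (step_proj x) (step_proj y) <= r%:E)%E ->
  inset a s (t - r) (pos (step_proj y)).
Proof.
move=> H hr i; have := H i.
have := le_trans (pos_lip cS (step_proj x) (step_proj y) i) hr.
rewrite lee_fin ler_norml; lra.
Qed.

Lemma rho_cases x y r : rho x y = r%:E ->
  (common_sheet x y /\ dist (step_proj x) (step_proj y) = r%:E) \/
  r = slen S / (4 * n)%:R.
Proof.
rewrite /step_rho; case: asboolP => [c ->|_]; first by left.
by case: asboolP => // _ [<-]; right.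
Qed.

(** To leave a copy of the core one has to jump, at a cost of at least t, or to
    reach the boundary of the core, at a depth of at least t. *)
Lemma core_separation (Q : cell R S) t x y :
  to_double first Q -> body Q (step_proj x) ->
  inset (core_corner Q) (slen S / 3) t (pos (step_proj x)) ->
  t <= slen S / (4 * n)%:R -> (sdist x y < t%:E)%E ->
  core_interior Q (step_proj y) /\ colour y = colour x.
Proof.
move=> dQ Qx tx tn xy.
(* The budget shrinks along the chain, so that it stays below the jump cost. *)
pose W (t : R) (z : T) := [/\ t <= slen S / (4 * n)%:R, body Q (step_proj z),
  inset (core_corner Q) (slen S / 3) t (pos (step_proj z)) &
  colour z = colour x].
have [||t' t'0 [_ Qy ty cy]] := @step_dist_ind _ _ _ _ cS W t x y _ _ xy.
- move=> {tx xy tn}t z w r [tn Qz tz cz] zw /andP[r0 rt].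
  have [[[ch [cz1 cw1]] dzw]|E] := rho_cases zw; last by move: tn;
    rewrite -E leNgt rt.
  have Qw : body Q (step_proj w).
    apply: (cell_ball cS (sub_to_double dQ) Qz (core_inset_cell tz)).
    by rewrite dzw lte_fin.
  have tw : inset (core_corner Q) (slen S / 3) (t - r) (pos (step_proj w)).
    by apply: inset_move tz _; rewrite dzw.
  split=> //; first lra.
  rewrite -cz (cz1 Q dQ) ?(cw1 Q dQ)//; split=> //.
    by apply: obox_inset tw; rewrite subr_gt0.
  by apply: obox_inset tz; apply: le_lt_trans rt.
- by [].
by split=> //; split=> //; exact: obox_inset ty.
Qed.

Definition triple_index (i j k : nat) (r : 'I_3) : nat := nth 0%N [:: i; j; k] r.

Lemma subcell_coord (Q : cell R S) i j k r :
  coord (subcell_corner N Q i j k) r =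
  coord (corner Q) r + h * (triple_index i j k r)%:R.
Proof. by rewrite coord_shift; case: r => [[|[|[|]]]]. Qed.

Lemma triple_index_lt i j k r : (i < M)%N -> (j < M)%N -> (k < M)%N ->
  (triple_index i j k r < M)%N.
Proof. by case: r => [[|[|[|]]]]. Qed.

Section Subcell.
Variables (Q : cell R S) (i j k : nat).
Hypotheses (iM : (i < M)%N) (jM : (j < M)%N) (kM : (k < M)%N).
Hypothesis cQ : @cells _ S Q.
Local Notation a := (subcell_corner N Q i j k).

Lemma subcell_cbox z : cbox a h z -> cbox (corner Q) (slen S) z.
Proof.
move=> H r; have := H r; rewrite subcell_coord.
have := subdivision_le h_gt0 hM (triple_index_lt r iM jM kM); lra.
Qed.

Lemma subcell_obox z : obox a h z -> obox (corner Q) (slen S) z.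
Proof.
move=> H r; have := H r; rewrite subcell_coord.
have := subdivision_le h_gt0 hM (triple_index_lt r iM jM kM); lra.
Qed.

Lemma subcell_inset t z : inset a h t z -> inset (corner Q) (slen S) t z.
Proof.
move=> H r; have := H r; rewrite subcell_coord.
have := subdivision_le h_gt0 hM (triple_index_lt r iM jM kM); lra.
Qed.

(** By [subdivision_core], a subcell that meets the interior of the core has its
    own interior in it. *)
Lemma subcell_core z w : cbox a h z -> obox (core_corner Q) (slen S / 3) z ->
  obox a h w -> obox (core_corner Q) (slen S / 3) w.
Proof.
move=> H Hc H' r; have := H' r; have := H r; have := Hc r.
rewrite subcell_coord core_coord => h1 h2 h3.
have [||] := @subdivision_core _ _ _ _ (triple_index i j k r) h_gt0 hM N3; lra.
Qed.

(** Interiors of cells are disjoint from other cells, so that no cell other than Q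
    can double a point inside Q. *)
Lemma subcell_doubled (u : S) : body Q u -> obox (corner Q) (slen S) (pos u) ->
  doubled first u -> core_interior Q u /\ to_double first Q.
Proof.
move=> Qu ou [Q' dQ' Q'u]; suff -> : Q = Q' by [].
by apply: (cell_interior cS cQ (sub_to_double dQ')) => //; case: Q'u.
Qed.

End Subcell.

Lemma obox_cbox (a : R3 R) s z : obox a s z -> cbox a s z.
Proof. by move=> H i; have := H i; lra. Qed.

(** A chain of cost less than t from a point at depth t does not reach the
    boundary of the subcell, and cannot afford a jump. Its links stay on sheets,
    which over the core of Q have one colour, so that they do not move to
    another lift of the subcell either. *)
Lemma subcell_ball c (Q : cell R S) (i j k : 'I_M) x y t : @cells _ S Q ->
  body (subcell N first c Q i j k) x ->
  inset (subcell_corner N Q i j k) h t (pos (step_proj x)) ->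
  (sdist x y < t%:E)%E -> body (subcell N first c Q i j k) y.
Proof.
move=> cQ Cx tx xy.
pose W (t : R) (z : T) := body (subcell N first c Q i j k) z /\
  inset (subcell_corner N Q i j k) h t (pos (step_proj z)).
have [||t' t'0 []//] := @step_dist_ind _ _ _ _ cS W t x y _ _ xy; last by [].
move=> {xy tx Cx x y}t x y r [[Qx ax colx] tx] xy /andP[r0 rt].
have t0 : 0 < t by exact: le_lt_trans rt.
have [[[ch [chx chy]] dxy]|E] := rho_cases xy; last first.
  (* A budget t <= h / 2 does not pay for a jump. *)
  have := jump_cost_large; have := tx ord0; lra.
have Qy : body Q (step_proj y).
  apply: (cell_ball cS cQ Qx).
    exact: (subcell_inset (ltn_ord i) (ltn_ord j) (ltn_ord k) tx).
  by rewrite dxy lte_fin.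
have ty : inset (subcell_corner N Q i j k) h (t - r) (pos (step_proj y)).
  by apply: inset_move tx _; rewrite dxy.
have oy : obox (subcell_corner N Q i j k) h (pos (step_proj y)).
  by apply: obox_inset ty; rewrite subr_gt0.
have ox : obox (subcell_corner N Q i j k) h (pos (step_proj x)).
  exact: obox_inset tx.
split=> //; split=> //; first exact: obox_cbox.
have [yd|yd] := pselect (doubled first (step_proj y)); last first.
  by left; apply: contrapT => /(svalP y).1.
have [Qcy dQ] := subcell_doubled cQ Qy
  (subcell_obox (ltn_ord i) (ltn_ord j) (ltn_ord k) oy) yd.
have Qcx : core_interior Q (step_proj x).
  by split=> //; apply: subcell_core (obox_cbox oy) _ ox; case: Qcy.
by rewrite (chy Q dQ Qcy) -(chx Q dQ Qcx).
Qed.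

(** A subcell with an uncoloured interior point lies outside the core and has no
    coloured points at all, whence its two lifts are the same cell. This is why
    the conclusion is an equality of cells and not of colours. *)
Lemma subcell_interior c c' (Q Q' : cell R S) (i j k i' j' k' : 'I_M) x :
  @cells _ S Q -> @cells _ S Q' ->
  body (subcell N first c Q i j k) x -> body (subcell N first c' Q' i' j' k') x ->
  obox (subcell_corner N Q i j k) h (pos (step_proj x)) ->
  subcell N first c Q i j k = subcell N first c' Q' i' j' k'.
Proof.
move=> cQ cQ' [Qx ax colx] [Q'x a'x colx'] ox.
have oQ := subcell_obox (ltn_ord i) (ltn_ord j) (ltn_ord k) ox.
have EQ : Q = Q' by exact: (cell_interior cS cQ cQ' Qx Q'x oQ).
subst Q'.
have Eidx r : triple_index i j k r = triple_index i' j' k' r.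
  have := ox r; have := a'x r; rewrite !subcell_coord => h1 h2.
  pose u := coord (pos (step_proj x)) r - coord (corner Q) r.
  by apply: (@subdivision_inj _ _ u _ _ h_gt0); rewrite /u; lra.
have Ei : i = i' by apply/val_inj; exact: (Eidx ord0).
have Ej : j = j' by apply/val_inj; exact: (Eidx (@Ordinal 3 1 isT)).
have Ek : k = k' by apply/val_inj; exact: (Eidx (@Ordinal 3 2 isT)).
subst i' j' k'.
have [cc'|cc'] := pselect (c = c'); first by rewrite cc'.
have xN : colour x = None.
  by case: colx => // cx; case: colx' => // c'x; move: c'x; rewrite cx => -[].
(* The whole subcell is uncoloured along with the interior point x. *)
have nd y : cbox (subcell_corner N Q i j k) h (pos (step_proj y)) ->
    body Q (step_proj y) -> colour y = None.
  move=> ay Qy; apply: contrapT => /(svalP y).1 [Q2 dQ2 Q2y].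
  have EQ : Q2 = Q.
    have [Q2b Q2o] := Q2y.
    apply: (cell_interior cS (sub_to_double dQ2) cQ Q2b Qy) => r.
    by have := Q2o r; rewrite core_coord; have := slen_gt0 cS; lra.
  subst Q2; have : doubled first (step_proj x).
    exists Q => //; split=> //; apply: subcell_core (ay) _ ox.
    by case: Q2y.
  by move/(svalP x).2.
congr Cell; apply/seteqP; split=> y [Qy ay _]; split=> //; left; exact: nd.
Qed.

Lemma center_exists (Q : cell R S) : @cells _ S Q ->
  exists2 z, body Q z & pos z = shift (corner Q) (slen S / 2) 1 1 1.
Proof.
move=> cQ; apply: cell_surj => // r; rewrite coord_shift.
by have := slen_gt0 cS; case: r => [[|[|[|]]]]//= ?; lra.
Qed.

Lemma center_dist (Q : cell R S) (u z : S) t : @cells _ S Q ->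
  body Q u -> body Q z -> pos z = shift (corner Q) (slen S / 2) 1 1 1 ->
  inset (corner Q) (slen S) (slen S / 2 - t) (pos u) ->
  (dist u z <= (2 * t)%:E)%E.
Proof.
move=> cQ Qu Qz pz ut; apply: (cell_dist cS cQ) => // r.
have := ut r; rewrite pz coord_shift ler_norml.
by case: r => [[|[|[|]]]]//= ?; lra.
Qed.

(** If no sheet contains both points, then x lies in a doubled core, and a detour
    through the centre of that core costs little. *)
Lemma step_dist_le x y :
  (sdist x y <= dist (step_proj x) (step_proj y) + (3 * slen S)%:E)%E.
Proof.
have s0 := slen_gt0 cS.
have [[c [cx cy]]|nc] := pselect (exists c,
    (colour x = None \/ colour x = Some c) /\
      (colour y = None \/ colour y = Some c)).
  apply: le_trans (same_colour_dist n cx cy) _.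
  by rewrite leeDl// lee_fin mulr_ge0// ltW.
have [Q dQ [Qx _]] : doubled first (step_proj x).
  apply/(svalP x) => cx; apply: nc.
  case E : (colour y) => [c|]; [exists c|exists Green].
    by split; [left|right].
  by split; left.
have cQ := sub_to_double dQ.
have [z Qz pz] := center_exists cQ.
have xz : (dist (step_proj x) z <= (slen S)%:E)%E.
  have -> : slen S = 2 * (slen S / 2) by lra.
  apply: (center_dist cQ) => // r; have := cell_pos cS cQ Qx r; lra.
apply: le_trans (through_center n cS x y dQ Qz pz) _.
have zy := dist_triangle cS (step_proj x) z (step_proj y).
rewrite (distC cS z (step_proj x)) in zy.
have j : slen S / (4 * n)%:R <= slen S.
  by rewrite ler_pdivrMr ?ltr0n ?muln_gt0// ler_peMr// ?ler1n ?muln_gt0// ltW.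
move: xz zy.
rewrite -(fineK (dist_fin cS (step_proj x) z)).
rewrite -(fineK (dist_fin cS z (step_proj y))).
rewrite -(fineK (dist_fin cS (step_proj x) (step_proj y))) -!EFinD !lee_fin; lra.
Qed.

Theorem cubical_step : cubical (step n N first S).
Proof.
have M0 : (0 < M)%N by rewrite addn1.
split=> /=.
- exact: h_gt0.
- exact: step_dist_ge0.
- move=> x y; rewrite ge0_fin_numE ?step_dist_ge0//.
  apply: le_lt_trans (step_dist_le x y) _.
  rewrite -ge0_fin_numE ?fin_numD ?dist_fin// adde_ge0 ?dist_ge0//.
  by rewrite lee_fin mulr_ge0// ltW// (slen_gt0 cS).
- exact: step_distxx.
- exact: step_distC.
- exact: step_dist_triangle.
- exact: step_pos_lip.
- move=> x; have [Q cQ Qx] := cell_cover cS (step_proj x).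
  have Px := cell_pos cS cQ Qx.
  have idx r : exists2 i :
    'I_M, coord (corner Q) r + h * i%:R <= coord (pos (step_proj x)) r &
      coord (pos (step_proj x)) r <= coord (corner Q) r + h * i%:R + h.
    have [||i i1 i2] := @subdivision_cover R (slen S) h
      (coord (pos (step_proj x)) r - coord (corner Q) r) M h_gt0 hM.
    + by have := Px r; lra.
    + exact: M0.
    + by exists i; lra.
  have [i i1 i2] := idx ord0; have [j j1 j2] := idx (inord 1).
  have [k k1 k2] := idx (inord 2).
  have [c hc] : exists c, colour x = None \/ colour x = Some c.
    by case: (colour x) => [c|]; [exists c; right|exists Green; left].
  exists (subcell N first c Q i j k); first by exists c, Q, i, j, k.
  split=> //; move=> r; rewrite subcell_coord.
  have : [|| r == ord0, r == inord 1 | r == inord 2].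
    rewrite -!val_eqE /= !inordK//; by case: r => [[|[|[|]]]].
  by case/or3P => /eqP->; rewrite /triple_index /= ?inordK//=; apply/andP.
- move=> C x [c [Q [i [j [k [cQ ->]]]]]] [] //.
- move=> C x y [c [Q [i [j [k [cQ ->]]]]]] [Qx ax cx] [Qy ay cy] pxy.
  have E := cell_inj cS cQ Qx Qy pxy.
  case: x y E Qx ax cx Qy ay cy pxy => [[u a] pu] [[v b] pv] /= E.
  rewrite /colour /step_proj /= in E *.
  move=> _ _ cx _ _ cy _; subst v; suff E : a = b.
    by subst b; congr exist; exact: Prop_irrelevance.
  have ab : a <> None <-> b <> None by rewrite pu pv.
  by case: cx cy ab => -> [] -> // ab; [have := ab.2|have := ab.1]; case.
- move=> C z [c [Q [i [j [k [cQ ->]]]]]] /= az.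
  have Qz := subcell_cbox (ltn_ord i) (ltn_ord j) (ltn_ord k) az.
  have [u Qu pu] := cell_surj cS cQ Qz.
  exists (lift_sheet first c u) => //; split; rewrite /= ?pu//.
  exact: lift_sheet_colour.
- move=> C x y t [c [Q [i [j [k [cQ ->]]]]]] [Qx ax cx] [Qy ay cy] /= txy.
  apply: le_trans (same_colour_dist n cx cy) _.
  exact: (cell_dist cS cQ).
- move=> C x y t [c [Q [i [j [k [cQ ->]]]]]]; exact: subcell_ball.
- move=> C C' x [c [Q [i [j [k [cQ ->]]]]]] [c' [Q' [i' [j' [k' [cQ' ->]]]]]].
  exact: subcell_interior.
Qed.

End StepGeometry.

(** * The unit cube *)

Lemma sum3 (R : realType) (f : 'I_3 -> R) :
  \sum_(i < 3) f i = f ord0 + f (inord 1) + f (inord 2).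
Proof.
rewrite !big_ord_recl big_ord0 addr0 addrA.
by congr (_ + f _ + f _); apply/val_inj; rewrite /= ?inordK.
Qed.

Section Euclid.
Variable R : realType.
Implicit Types x y z : R3 R.

Lemma euclid_coord x y i : `|coord x i - coord y i| <= euclid x y.
Proof.
rewrite -sqrtr_sqr ler_wsqrtr// (bigD1 i)//= lerDl.
by apply: sumr_ge0 => j _; exact: sqr_ge0.
Qed.

Lemma euclid_le x y t : (forall i, `|coord x i - coord y i| <= t) ->
  euclid x y <= 2 * t.
Proof.
move=> H; have t0 : 0 <= t by apply: le_trans (H ord0).
rewrite -[2 * t]ger0_norm ?mulr_ge0// -sqrtr_sqr ler_wsqrtr//.
have sq i : (coord x i - coord y i) ^+ 2 <= t ^+ 2.
  by rewrite -real_normK ?num_real// lerXn2r ?nnegrE.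
rewrite sum3; have := sq ord0; have := sq (inord 1); have := sq (inord 2).
have := sqr_ge0 t; rewrite exprMn; lra.
Qed.

Lemma euclidC x y : euclid x y = euclid y x.
Proof. by congr Num.sqrt; apply: eq_bigr => i _; rewrite -sqrrN opprB. Qed.

Lemma euclidxx x : euclid x x = 0.
Proof.
rewrite /euclid big1 ?sqrtr0// => i _; by rewrite subrr expr0n.
Qed.

Lemma euclid_triangle y x z : euclid x z <= euclid x y + euclid y z.
Proof.
rewrite -[leRHS]ger0_norm ?addr_ge0 ?sqrtr_ge0// -sqrtr_sqr ler_wsqrtr//.
have sumsq_ge0 (f : 'I_3 -> R) : 0 <= \sum_(i < 3) f i ^+ 2.
  by apply: sumr_ge0 => i _; exact: sqr_ge0.
rewrite sqrrD !sqr_sqrtr//.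
suff : \sum_(i < 3) (coord x i - coord y i) * (coord y i - coord z i) <=
    euclid x y * euclid y z.
  rewrite /euclid !sum3; move: (Num.sqrt _) (Num.sqrt _) => a b; lra.
rewrite -sqrtrM//.
apply: le_trans (ler_norm _) _; rewrite -sqrtr_sqr ler_wsqrtr// !sum3.
move: (coord x _ - _) (coord y _ - coord z _) (coord x _ - _)
  (coord y _ - coord z _) (coord x _ - _) (coord y _ - coord z _)
  => a a' b b' c c'.
rewrite -subr_ge0.
(* Lagrange's identity. *)
rewrite (_ : _ - _ = (a * b' - b * a') ^+ 2 +
  ((a * c' - c * a') ^+ 2 + (b * c' - c * b') ^+ 2)); last by ring.
by rewrite !addr_ge0 ?sqr_ge0.
Qed.

Lemma cubical_stage0 : cubical (stage0 R).
Proof.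
split=> /=.
- exact: ltr01.
- by move=> x y; rewrite lee_fin sqrtr_ge0.
- by [].
- by move=> x; rewrite euclidxx.
- by move=> x y; rewrite euclidC.
- by move=> y x z; rewrite -EFinD lee_fin euclid_triangle.
- by move=> x y i; rewrite lee_fin euclid_coord.
- by move=> x; exists (Cell (0, 0, 0) setT).
- by move=> Q x -> _; exact: (svalP x).
- by move=> Q x y _ _ _ xy; case: x y xy => [x px] [y py] /= xy; subst y;
    congr exist; exact: Prop_irrelevance.
- by move=> Q z -> cz; exists (exist _ z cz).
- by move=> Q x y t _ _ _ H; rewrite lee_fin euclid_le.
- by move=> Q x y t ->.
- by move=> Q Q' x -> ->.
Qed.

End Euclid.

(** * The limit distance *)

Section Tower.
Variables (R : realType) (n0 : nat) (N : nat -> nat).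
Hypothesis hn0 : (100 <= n0)%N.
Hypothesis hN3 : forall n, (26 <= n)%N -> (3 %| 2 * N n + 1)%N.
Hypothesis hN : forall n, (26 <= n)%N ->
  1 / (2 * N n + 1)%:R \in `[1 / (128 * n)%:R, (1 / (32 * n)%:R : R)].
Local Notation X := (X R n0 N).
Local Notation Xinf := (Xinf R n0 N).
Local Notation dinf := (@dinf R n0 N).
Implicit Types p q x y : Xinf.

(** The parameter n_(k+1) with which X_(l+1) is made from X_l. *)
Definition stage_n l := nk n0 (level n0 l).+1.
Definition subdiv l := (2 * N (stage_n l) + 1)%N.

Lemma n0_gt0 : (0 < n0)%N. Proof. exact: leq_trans hn0. Qed.

Lemma stage_n_ge l : (100 <= stage_n l)%N.
Proof. by rewrite (leq_trans hn0)// leq_addr. Qed.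

Lemma subdiv_bounds n : (26 <= n)%N -> (32 * n <= 2 * N n + 1 <= 128 * n)%N.
Proof.
move=> n26; have n1 : (0 < n)%N by exact: leq_trans n26.
have := hN n26; rewrite in_itv/= !div1r => /andP[].
rewrite !lef_pV2 ?posrE ?ltr0n ?muln_gt0 ?addn1// !ler_nat; lia.
Qed.

Lemma subdiv_ge l : (32 * stage_n l <= subdiv l)%N.
Proof.
by have /subdiv_bounds/andP[] := leq_trans (isT : 26 <= 100)%N (stage_n_ge l).
Qed.

Lemma subdiv_le l : (subdiv l <= 128 * stage_n l)%N.
Proof.
by have /subdiv_bounds/andP[] := leq_trans (isT : 26 <= 100)%N (stage_n_ge l).
Qed.

Lemma subdiv3 l : (3 %| subdiv l)%N.
Proof. by apply: hN3; exact: leq_trans (stage_n_ge l). Qed.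

Lemma stage_n_gt0 l : (0 < stage_n l)%N.
Proof. exact: leq_trans (stage_n_ge l). Qed.

Lemma cubical_X l : cubical (X l).
Proof.
elim: l => [|l IH]; first exact: cubical_stage0.
by apply: cubical_step => //;
  [exact: stage_n_gt0|exact: subdiv3|exact: subdiv_ge].
Qed.

Lemma slen_X l : slen (X l) = slen (X l.+1) * (subdiv l)%:R.
Proof. by rewrite /= divfK// pnatr_eq0 addn1. Qed.

Lemma slen_X_gt0 l : 0 < slen (X l). Proof. exact: slen_gt0 (cubical_X l). Qed.

Lemma slen_X_decr l (k : nat) : (k <= subdiv l)%N ->
  slen (X l.+1) * k%:R <= slen (X l).
Proof. by move=> kr; rewrite [leRHS]slen_X ler_pM2l ?slen_X_gt0// ler_nat. Qed.

Lemma slen_X_step l : slen (X l.+1) * 6 <= slen (X l).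
Proof. by apply: slen_X_decr; have := subdiv_ge l; have := stage_n_ge l; lia. Qed.

Lemma slen_X_le l : slen (X l) <= 2^-1 ^+ l.
Proof.
elim: l => [|l IH]; first by rewrite expr0.
have := slen_X_step l; have := slen_X_gt0 l.+1; move: IH; rewrite exprS.
move: (2^-1 ^+ l) (slen (X l)) (slen (X l.+1)) => *; lra.
Qed.

Lemma prj_infS l x : step_proj (prj_inf l.+1 x) = prj_inf l x.
Proof. exact: (svalP x l). Qed.

Definition level_dist l x y : \bar R := dist (prj_inf l x) (prj_inf l y).

Lemma level_distS l x y : (level_dist l x y <= level_dist l.+1 x y)%E.
Proof.
rewrite {1}/level_dist -(prj_infS l x) -(prj_infS l y).
exact: (step_dist_proj _ (cubical_X l)).
Qed.

Lemma level_dist_mono x y : {homo (fun l => level_dist l x y) :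
  k l / (k <= l)%N >-> (k <= l)%E}.
Proof.
by apply: homo_leq => [//|??? /le_trans|l]; [exact|exact: level_distS].
Qed.

Lemma level_dist_step l x y :
  (level_dist l.+1 x y <= level_dist l x y + (3 * slen (X l))%:E)%E.
Proof.
rewrite [X in (_ <= X + _)%E]/level_dist -(prj_infS l x) -(prj_infS l y).
by apply: (step_dist_le (cubical_X l)); [exact: stage_n_gt0].
Qed.

(** The increments 3 * slen (X i) decrease at least geometrically with ratio 1/6,
    so that they add up to at most 4 * slen (X l). *)
Lemma level_dist_tail l x y i :
  (level_dist (l + i) x y <= level_dist l x y + (4 * slen (X l))%:E)%E.
Proof.
suff : (level_dist (l + i) x y + (4 * slen (X (l + i)))%:E <=
  level_dist l x y + (4 * slen (X l))%:E)%E.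
  by apply: le_trans; rewrite leeDl// lee_fin mulr_ge0// ltW// slen_X_gt0.
elim: i => [|i]; first by rewrite addn0.
apply: le_trans; rewrite addnS;
  apply: le_trans (leeD (level_dist_step _ _ _) (lexx _)) _.
by rewrite -addeA leeD2l// -EFinD lee_fin; have := slen_X_step (l + i);
  have := slen_X_gt0 (l + i); lra.
Qed.

(** Distances increase with the level, so that the upper limit is a supremum. *)
Lemma level_dist_le_dinf l x y : (level_dist l x y <= dinf x y)%E.
Proof.
apply: le_ereal_inf_tmp => _ [V [k _ kV] <-].
apply: (@le_trans _ _ (level_dist (maxn k l) x y)).
  by apply: level_dist_mono; exact: leq_maxr.
by apply: ereal_sup_ubound; exists (maxn k l) => //; apply: kV => /=;
  exact: leq_maxl.
Qed.

Lemma dinf_le_sup x y (b : \bar R) : (forall l, (level_dist l x y <= b)%E) ->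
  (dinf x y <= b)%E.
Proof.
move=> H.
apply: (@le_trans _ _ (ereal_sup (range (fun i => level_dist i x y)))).
  by apply: ereal_inf_lbound; exists setT => //; exact: filterT.
by apply: ge_ereal_sup => _ [i _ <-].
Qed.

Lemma dinf_le l x y : (dinf x y <= level_dist l x y + (4 * slen (X l))%:E)%E.
Proof.
apply: dinf_le_sup => i.
have [li|il] := leqP l i; first by rewrite -(subnKC li) level_dist_tail.
apply: le_trans (level_dist_mono x y (ltnW il)) _.
by rewrite leeDl// lee_fin mulr_ge0// ltW// slen_X_gt0.
Qed.

Lemma dinf_fin x y : dinf x y \is a fin_num.
Proof.
have f0 := dist_fin (cubical_X 0) (prj_inf 0 x) (prj_inf 0 y).
rewrite ge0_fin_numE; last first.
  by apply: le_trans (level_dist_le_dinf 0 x y);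
    exact: dist_ge0 (cubical_X 0) _ _.
apply: le_lt_trans (dinf_le 0 x y) _.
rewrite -ge0_fin_numE ?fin_numD ?f0// adde_ge0// ?(dist_ge0 (cubical_X 0))//.
by rewrite lee_fin mulr_ge0// ltW// slen_X_gt0.
Qed.

Definition limit_dist x y : R := fine (dinf x y).

Lemma limit_distE x y : dinf x y = (limit_dist x y)%:E.
Proof. by rewrite fineK// dinf_fin. Qed.

Lemma limit_distxx x : limit_dist x x = 0.
Proof.
apply/eqP; rewrite eq_le -!lee_fin -limit_distE; apply/andP; split.
  by apply: dinf_le_sup => l; rewrite /level_dist distxx//; exact: cubical_X.
by apply: le_trans (level_dist_le_dinf 0 x x); exact: dist_ge0 (cubical_X 0) _ _.
Qed.

Lemma limit_distC x y : limit_dist x y = limit_dist y x.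
Proof.
rewrite /limit_dist /dinf; congr (fine (limn_esup _)); apply/funext => l.
exact: distC (cubical_X l) _ _.
Qed.

Lemma limit_dist_triangle y x z :
  limit_dist x z <= limit_dist x y + limit_dist y z.
Proof.
rewrite -lee_fin EFinD -!limit_distE; apply: dinf_le_sup => l.
apply: le_trans (dist_triangle (cubical_X l) (prj_inf l y) _ _) _.
by apply: leeD; exact: level_dist_le_dinf.
Qed.

Definition limit_semimetric :=
  SemiMetric limit_distxx limit_distC limit_dist_triangle.

Lemma lift_sheet_eq (first : bool) (S : stage R) c (u : step_pts first S) :
  colour u = None \/ colour u = Some c -> u = lift_sheet first c (step_proj u).
Proof.
case: u => [[u a] pu]; rewrite /colour /step_proj/= => ac.
rewrite /lift_sheet; move: (lift_proof _ _ _); rewrite /lift_pair/=.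
have -> : (if `[< doubled first u >] then Some c else None) = a.
  case: asboolP => [/pu/=|nd]; first by case: ac => ->.
  by case: ac => //= ac; case: nd; apply/pu; rewrite /= ac.
by move=> pu'; congr exist; exact: Prop_irrelevance.
Qed.

(** A point of the limit is given by a point of the unit cube and one colour for
    each level, which matters only where the point is doubled. *)
Fixpoint steer (u0 : X 0) (w : nat -> color) l : X l :=
  if l is l'.+1 then lift_sheet _ (w l') (steer u0 w l') else u0.

Definition steered u0 w : Xinf :=
  exist (fun x : forall l, X l => forall l, prj (x l.+1) = x l)
    (steer u0 w) (fun=> erefl).

Lemma steered_exists x :
  exists w, forall l, prj_inf l x = steer (prj_inf 0 x) w l.
Proof.
exists (fun l => odflt Green (colour (prj_inf l.+1 x))); elim=> // l IH.
rewrite /= -IH -(prj_infS l x); apply: lift_sheet_eq.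
by case: (colour _) => [c|]; [right|left].
Qed.

(** Alter the colour chosen at level l and keep those of the other levels. *)
Lemma change_colour x l c : exists y,
  prj_inf l y = prj_inf l x /\ prj_inf l.+1 y = lift_sheet _ c (prj_inf l x).
Proof.
have [w hw] := steered_exists x.
pose w' i := if i == l then c else w i.
have E i : (i <= l)%N -> steer (prj_inf 0 x) w' i = prj_inf i x.
  rewrite (hw i); elim: i => // i IH il.
  by rewrite /= IH ?(ltnW il)// /w' (ltn_eqF il).
exists (steered (prj_inf 0 x) w'); split; first exact: E.
by rewrite {1}/prj_inf /= (E l)// /w' eqxx.
Qed.

Lemma nbar_mono : {homo nbar n0 : k l / (k <= l)%N}.
Proof.
apply: homo_leq => // [??? /leq_trans|k]; first exact.
by rewrite /nbar [leqRHS]big_nat_recr//= leq_addr.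
Qed.

Lemma level_ge k l : (nbar n0 k <= l)%N -> (k <= level n0 l)%N.
Proof.
move=> kl; rewrite leqNgt; apply/negP => lk.
have /andP[_] := levelP l n0_gt0; rewrite ltnNge => /negP; apply.
exact: leq_trans (nbar_mono lk) kl.
Qed.

Lemma level_phase k l : (nbar n0 k <= l < nbar n0 k.+1)%N -> level n0 l = k.
Proof.
move=> /andP[kl lk]; apply/eqP; rewrite eqn_leq level_ge// andbT leqNgt.
apply/negP => h; move: lk; rewrite ltnNge => /negP; apply.
have /andP[H _] := levelP l n0_gt0; exact: leq_trans (nbar_mono h) H.
Qed.

Lemma subdiv_large A : exists L, forall l, (L <= l)%N -> (A <= subdiv l)%N.
Proof.
exists (nbar n0 A) => l /level_ge Al; have := subdiv_ge l.
by rewrite /stage_n /nk; lia.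
Qed.

End Tower.

(** * The space at the scale of a gate *)

Section Gates.
Variables (R : realType) (n0 : nat) (N : nat -> nat).
Hypothesis hn0 : (100 <= n0)%N.
Hypothesis hN3 : forall n, (26 <= n)%N -> (3 %| 2 * N n + 1)%N.
Hypothesis hN : forall n, (26 <= n)%N ->
  1 / (2 * N n + 1)%:R \in `[1 / (128 * n)%:R, (1 / (32 * n)%:R : R)].
Local Notation X := (X R n0 N).
Local Notation Xinf := (Xinf R n0 N).
Local Notation stage_n := (stage_n n0).
Local Notation subdiv := (subdiv n0 N).
Local Notation d := (limit_semimetric hn0 hN3 hN).
Local Notation cX := (cubical_X hn0 hN3 hN).
Implicit Types p q x y : Xinf.

Definition first_step l := l == nbar n0 (level n0 l).

(** The central subcell of Q has the indices (N, N, N). *)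
Definition in_gate l x : Prop := exists c (Q : cell R (X l)),
  to_double (first_step l) Q /\
  body (subcell (N (stage_n l)) (first_step l) c Q
      (N (stage_n l)) (N (stage_n l)) (N (stage_n l))) (prj_inf l.+1 x).

Definition level_colour l x : option color :=
  @colour R (first_step l) (X l) (prj_inf l.+1 x).

Lemma limit_dist_lt_level l x y (r : R) : d x y < r ->
  (level_dist l x y < r%:E)%E.
Proof.
move=> xy; apply: le_lt_trans (level_dist_le_dinf hn0 hN3 hN l x y) _.
by rewrite (limit_distE hn0 hN3 hN) lte_fin.
Qed.

Lemma limit_dist_le_level l x y (r : R) : (level_dist l x y <= r%:E)%E ->
  d x y <= r + 4 * slen (X l).
Proof.
move=> xy; rewrite -lee_fin -[(d x y)%:E](limit_distE hn0 hN3 hN).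
apply: le_trans (dinf_le hn0 hN3 hN l x y) _.
by rewrite EFinD leeD2r.
Qed.

(** Weaker than having the same colour, but enough for a common sheet: a red
    point and an uncoloured one both lie on the red sheet. *)
Definition same_green l x y : Prop :=
  `[< level_colour l x = Some Green >] = `[< level_colour l y = Some Green >].

Lemma same_green_colour l x y : same_green l x y ->
  exists c, (level_colour l x = None \/ level_colour l x = Some c) /\
    (level_colour l y = None \/ level_colour l y = Some c).
Proof.
move=> E; have [xG|xG] := pselect (level_colour l x = Some Green).
  have yG : level_colour l y = Some Green by apply/asboolP; rewrite -E;
    exact/asboolP.
  by exists Green; split; right.
have yG : level_colour l y <> Some Green by move=> /asboolP;
  rewrite -E => /asboolP.
exists Red; split.
  by case: (level_colour l x) xG => [[]|]; [case|right|left].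
by case: (level_colour l y) yG => [[]|]; [case|right|left].
Qed.

Lemma same_green_level_dist l x y : same_green l x y ->
  (level_dist l.+1 x y <= level_dist l x y)%E.
Proof.
move=> /same_green_colour[c [cx cy]].
rewrite [leRHS]/level_dist -(prj_infS l x) -(prj_infS l y).
exact: (same_colour_dist _ cx cy).
Qed.

Section Gate.
Variables (l : nat) (Q : cell R (X l)) (p : Xinf).
Hypothesis dQ : to_double (first_step l) Q.
Hypothesis pQ : body Q (prj_inf l p).
Local Notation s := (slen (X l.+1)).
Local Notation sl := (slen (X l)).
Hypothesis pc : forall i,
  `|coord (pos (prj_inf l p)) i - (coord (corner Q) i + sl / 2)| <= s / 2.
Variable m : nat.
Hypothesis hm : (6 * (m + 9) <= subdiv l)%N.

Let cQ : @cells _ (X l) Q := sub_to_double dQ.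
Let s_gt0 : 0 < s. Proof. exact: slen_X_gt0. Qed.
Let sl_ge : 6 * (m%:R + 9) * s <= sl.
Proof.
have := slen_X_decr hn0 hN3 hN hm.
by rewrite natrM natrD mulrC.
Qed.

(** The distance from the centre of Q to the boundary of its core is sl / 6, which
    is at least (m + 9) * s, and the gate takes up s / 2 of it. *)
Lemma gate_inset_core :
  inset (core_corner Q) (sl / 3) ((m%:R + 8) * s) (pos (prj_inf l p)).
Proof.
move=> i; have := pc i; rewrite core_coord ler_norml.
have : 0 <= m%:R * s by rewrite mulr_ge0// ltW.
move: sl_ge s_gt0; rewrite !mulrDl -mulrA; lra.
Qed.

Lemma gate_ball x : d p x < m%:R * s ->
  body Q (prj_inf l x) /\
  inset (core_corner Q) (sl / 3) (8 * s) (pos (prj_inf l x)).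
Proof.
move=> /(limit_dist_lt_level l) px.
have tp : inset (core_corner Q) (sl / 3) (m%:R * s) (pos (prj_inf l p)).
  by move=> i; have := gate_inset_core i; have := s_gt0; rewrite mulrDl; lra.
split; first by apply: (cell_ball (cX l) cQ pQ (core_inset_cell (cX l) tp)).
move=> i; have := gate_inset_core i.
have := le_lt_trans (pos_lip (cX l) (prj_inf l p) (prj_inf l x) i) px.
rewrite lte_fin ltr_norml mulrDl; lra.
Qed.

Lemma gate_separation x y : d p x < m%:R * s -> d x y < 8 * s ->
  level_colour l x = level_colour l y.
Proof.
move=> /gate_ball[Qx tx] /(limit_dist_lt_level l.+1) xy.
have jl : 8 * s <= sl / (4 * stage_n l)%:R.
  by apply: (jump_cost_large (cX l) (stage_n_gt0 hn0 l));
    exact: (subdiv_ge hn0 hN).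
rewrite -(prj_infS l x) in Qx tx.
have [_ E] := core_separation (cX l) dQ Qx tx jl xy; exact: esym E.
Qed.

(** The ball of radius m * s is cut into cubes of side s / (4 * (m + 1)), and
    each of them into four parts according to the colours at the levels l and
    l + 1. The higher levels change distances by at most 4 * slen (X l.+2),
    which is small compared with s. *)
Lemma gate_cover : (16 * m.+1 <= subdiv l.+1)%N ->
  let K := (8 * m * m.+1)%N in
  exists g : Xinf -> 'I_K.+1 * 'I_K.+1 * 'I_K.+1 * bool * bool,
  forall x y, d p x < m%:R * s -> d p y < m%:R * s -> g x = g y ->
    d x y <= s / m.+1%:R.
Proof.
move=> hm1 K.
pose u i x : R :=
  (coord (pos (prj_inf l x)) i - coord (pos (prj_inf l p)) i + m%:R * s)
  / (s / (4 * m.+1)%:R).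
have e0 : 0 < s / (4 * m.+1)%:R by rewrite divr_gt0 ?ltr0n.
have u_bound i x : d p x < m%:R * s -> 0 <= u i x < K.+1%:R.
  move=> /(limit_dist_lt_level l) px.
  have := le_lt_trans (pos_lip (cX l) (prj_inf l p) (prj_inf l x) i) px.
  rewrite lte_fin ltr_norml => px'; apply/andP; split.
    by rewrite divr_ge0// ?(ltW e0)//; lra.
  rewrite ltr_pdivrMr//; apply: (@lt_le_trans _ _ (2 * m%:R * s)); first lra.
  rewrite [leRHS]mulrA ler_pdivlMr ?ltr0n// mulrAC ler_pM2r// -!natrM ler_nat.
  rewrite /K; lia.
pose k i x : 'I_K.+1 := inord (Num.truncn (u i x)).
exists (fun x => (k ord0 x, k (inord 1) x, k (inord 2) x,
  `[< level_colour l x = Some Green >], `[< level_colour l.+1 x = Some Green >])).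
move=> x y px py [k0 k1 k2 c0 c1].
have [Qx tx] := gate_ball px; have [Qy ty] := gate_ball py.
have kE i : k i x = k i y.
  have : [|| i == ord0, i == inord 1 | i == inord 2].
    by rewrite -!val_eqE /= !inordK//; case: i => [[|[|[|]]]].
  by case/or3P => /eqP->.
have close i : `|coord (pos (prj_inf l x)) i - coord (pos (prj_inf l y)) i| <=
  s / (4 * m.+1)%:R.
  have /andP[x0 xK] := u_bound i _ px; have /andP[y0 yK] := u_bound i _ py.
  have tK z : 0 <= u i z -> u i z < K.+1%:R -> (Num.truncn (u i z) < K.+1)%N.
    by move=> z0 zK; rewrite -(ltr_nat R); apply: le_lt_trans zK;
      rewrite truncn_le.
  have tE : Num.truncn (u i x) = Num.truncn (u i y).
    by have := congr1 val (kE i); rewrite /= !inordK ?tK.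
  have ltx := truncnS_gt (u i x); have lty := truncnS_gt (u i y).
  have lex : (Num.truncn (u i x))%:R <= u i x by rewrite truncn_le.
  have ley : (Num.truncn (u i y))%:R <= u i y by rewrite truncn_le.
  rewrite tE -natr1 in ltx lex; rewrite -natr1 in lty.
  have : `|u i x - u i y| <= 1 by rewrite ler_norml; lra.
  rewrite /u -mulrBl normrM [X in _ * X <= _ -> _]gtr0_norm ?invr_gt0//.
  by rewrite ler_pdivrMr// mul1r; congr (`|_| <= _); ring.
(* Common sheets at both levels reduce the distance to that of X_l, inside Q. *)
have h2 : (level_dist l.+2 x y <= (2 * (s / (4 * m.+1)%:R))%:E)%E.
  apply: le_trans (same_green_level_dist c1) _;
    apply: le_trans (same_green_level_dist c0) _.
  exact: (cell_dist (cX l) cQ).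
apply: le_trans (limit_dist_le_level h2) _.
have := slen_X_decr hn0 hN3 hN hm1; rewrite natrM => h3.
have m0 : 0 < m.+1%:R :> R by rewrite ltr0n.
have -> : s / (4 * m.+1)%:R = s / m.+1%:R / 4.
  by rewrite natrM invfM [4^-1 * _]mulrC mulrA.
have h4 : 16 * slen (X l.+2) <= s / m.+1%:R.
  rewrite ler_pdivlMr//; move: h3; move: (slen (X l.+2)) (m.+1%:R : R) => t v;
    lra.
have : 0 < s / m.+1%:R by exact: divr_gt0.
move: h4; move: (s / m.+1%:R) (slen (X l.+2)) => *; lra.
Qed.

(** Change the colour of p at level l. The new point is reached through the jump
    pair, by 2 * s for the ways to and from the centre and 32 * s for the jump,
    from 2 * N + 1 <= 128 * n; the higher levels add 4 * s. *)
Lemma gate_other : exists2 x, d p x <= 40 * s &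
  `[< level_colour l x = Some Green >] != `[< level_colour l p = Some Green >].
Proof.
have [z Qz pz] := center_exists (cX l) cQ.
have zp : (dist (prj_inf l p) z <= s%:E)%E.
  have -> : s = 2 * (s / 2) by lra.
  apply: (center_dist (cX l) cQ) => // i; have := pc i; rewrite ler_norml; lra.
have pd : doubled (first_step l) (prj_inf l p).
  exists Q => //; split=> //; apply: obox_inset gate_inset_core.
  by rewrite mulr_gt0// ltr_wpDl.
pose c := if level_colour l p is Some Green then Red else Green.
have [x [xp xc]] := change_colour p l c.
have cx : level_colour l x = Some c.
  by rewrite /level_colour xc; exact: lift_sheet_doubled.
exists x.
  have jump : slen (X l) / (4 * stage_n l)%:R <= 32 * s.
    rewrite ler_pdivrMr ?ltr0n ?muln_gt0 ?stage_n_gt0//.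
    rewrite [leLHS](slen_X R n0 N l); move: s_gt0; move: (slen (X l.+1)) => t t0.
    rewrite [32 * _]mulrC -mulrA ler_pM2l// -natrM ler_nat.
    by have := subdiv_le hn0 hN l; lia.
  suff H : (level_dist l.+1 p x <= (36 * s)%:E)%E by have :=
    limit_dist_le_level H; lra.
  apply: le_trans (through_center (stage_n l) (cX l) _ _ dQ Qz pz) _.
  rewrite !prj_infS xp (distC (cX l) z).
  apply: le_trans (leeD (leeD zp (lexx _)) zp) _.
  by rewrite -!EFinD lee_fin; move: jump s_gt0;
    move: (slen (X l) / (4 * stage_n l)%:R) (slen (X l.+1)) => *; lra.
rewrite cx /c; case E : (level_colour l p) => [[]|].
- by rewrite (asboolT (erefl : Some Green = Some Green)) asboolF.
- by rewrite asboolT// asboolF.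
- have pd' : doubled (first_step l) (step_proj (prj_inf l.+1 p)).
    by rewrite prj_infS.
  by have := (svalP (prj_inf l.+1 p)).2 pd';
    rewrite -[X in X <> _]/(level_colour l p) E.
Qed.

End Gate.

(** The central subcell has its centre at the centre of Q, because the number
    2 * N + 1 of subcells along an edge is odd. *)
Lemma in_gate_center l x : in_gate l x -> exists2 Q : cell R (X l),
  to_double (first_step l) Q & body Q (prj_inf l x) /\
  forall i, `|coord (pos (prj_inf l x)) i - (coord (corner Q) i + slen (X l) / 2)|
    <= slen (X l.+1) / 2.
Proof.
move=> [c [Q [dQ [Qx ax _]]]]; exists Q => //; rewrite prj_infS in Qx ax.
split=> // i; have := ax i; rewrite subcell_coord.
have -> k : triple_index k k k i = k by case: i => [[|[|[|]]]].
rewrite -[slen (X l) / _]/(slen (X l.+1)) (slen_X R n0 N l) /subdiv -/(stage_n l).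
rewrite natrD natrM ler_norml; lra.
Qed.

Theorem gates_disconnected_tangent p :
  (forall L, exists2 l, (L <= l)%N & in_gate l p) ->
  exists (Y : metricType R) (q : Y),
    tangent (@dinf R n0 N) p q /\ ~ connected [set: Y].
Proof.
move=> inf; pose pick L := sval (cid2 (inf L)).
(* An increasing sequence of levels at which p lies over a gate. *)
pose phi := fix phi j := if j is i.+1 then pick (phi i).+1 else pick 0%N.
have phiP j : in_gate (phi j) p by case: j => [|j] /=; rewrite /pick; case: cid2.
have phi_lt j : (phi j < phi j.+1)%N by rewrite /= /pick; case: cid2.
have phi_homo : {homo phi : m n / (m <= n)%N}.
  apply: homo_leq => //; first exact: leq_trans.
  by move=> i; exact: ltnW.
have phi_ge j : (j <= phi j)%N by elim: j => // j IH; apply: leq_ltn_trans IH _.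
have slen_homo : {homo (fun l => slen (X l)) : m n / (m <= n)%N >-> n <= m}.
  apply: homo_leq => // [a b c ab bc|l]; first exact: le_trans bc ab.
  have := slen_X_step hn0 hN3 hN l; have := slen_X_gt0 hn0 hN3 hN l.+1; lra.
have near_subdiv A : \forall j \near \oo, (A <= subdiv (phi j))%N /\
  (A <= subdiv (phi j).+1)%N.
  have [L hL] := subdiv_large hn0 hN A.
  exists L => // j /= Lj; have Lp := leq_trans Lj (phi_ge j).
  by split; apply: hL => //; exact: leqW.
apply: (@disconnected_tangent R Xinf (@dinf R n0 N) d p
  (fun j => slen (X (phi j).+1))
  (fun j x => `[< level_colour (phi j) x = Some Green >]) 40).
- exact: limit_distE.
- by move=> j; exact: slen_X_gt0.
- by move=> m n mn; apply: slen_homo; rewrite ltnS phi_homo.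
- apply: (@squeeze_cvgr _ _ _ _ (fun=> 0) (fun j => 2^-1 ^+ j)); last 2 first.
  + exact: cvg_cst.
  + by apply: cvg_expr; rewrite ger0_norm//; lra.
  near=> j; apply/andP; split; first by rewrite ltW// slen_X_gt0.
  apply: (@le_trans _ _ (slen (X j))).
    by apply: slen_homo; apply: leqW.
  exact: slen_X_le.
- move=> m; eexists.
  apply: filterS (near_subdiv (6 * (m + 9) + 16 * m.+1)%N) => j [h1 h2].
  have [Q dQ [Qp pc]] := in_gate_center (phiP j).
  apply: (gate_cover dQ Qp pc); lia.
- move=> m; apply: filterS (near_subdiv (6 * (m + 9))%N) => j [h1 _] x y px py.
  have [Q dQ [Qp pc]] := in_gate_center (phiP j).
  move=> /eqP cxy; rewrite leNgt; apply/negP => xy; apply: cxy.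
  have -> // : level_colour (phi j) x = level_colour (phi j) y.
  apply: (gate_separation dQ Qp pc h1 px); apply: lt_trans xy _.
  have := slen_X_gt0 hn0 hN3 hN (phi j).+1; lra.
- move=> j; have [Q dQ [Qp pc]] := in_gate_center (phiP j).
  apply: (gate_other dQ Qp pc (m := 0%N)).
  by have := subdiv_ge hn0 hN (phi j); have := stage_n_ge hn0 (phi j); lia.
Unshelve. all: by end_near. Qed.

End Gates.

(** * Volume of unions of cubes *)

Section Boxes.
Variable R : realType.
Local Notation lambda := (@lebesgue_measure R).
Local Notation vol := ((lambda \x lambda) \x lambda)%E.

Definition boxes (a : seq (R * R * R)%type) (s : R) : set (R * R * R)%type :=
  [set z | exists2 c, c \in a & cbox (c : R3 R) s z].

Lemma cboxE (a : R3 R) (s : R) : cbox a s =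
  (`[a.1.1, a.1.1 + s] `*` `[a.1.2, a.1.2 + s]) `*` `[a.2, a.2 + s].
Proof.
apply/seteqP; split=> z.
  move=> h; have := h ord0; have := h (@Ordinal 3 1 isT);
    have := h (@Ordinal 3 2 isT).
  by rewrite /coord /= !in_itv/=.
move=> [[/= h1 h2] h3] i; move: h1 h2 h3; rewrite !in_itv/= => h1 h2 h3.
by case: i => [[|[|[|]]]].
Qed.

Lemma measurable_cbox (a : R3 R) s : measurable (cbox a s : set (R * R * R)%type).
Proof.
by rewrite cboxE; apply: measurableX; [apply: measurableX|];
  exact: measurable_itv.
Qed.

Lemma vol_cbox (a : R3 R) s : 0 <= s -> vol (cbox a s) = (s ^+ 3)%:E.
Proof.
move=> s0; have itvE (u : R) : lambda `[u, u + s] = s%:E.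
  rewrite lebesgue_measure_itv /= lte_fin ltrDl; case: ltP => [_|s0'].
    by rewrite -EFinB addrAC subrr add0r.
  by congr EFin; apply/eqP; rewrite eq_le s0.
rewrite cboxE product_measure1E; [|by apply: measurableX;
  exact: measurable_itv|exact: measurable_itv].
rewrite /= product_measure1E; [|exact: measurable_itv..].
move: (itvE a.1.1) (itvE a.1.2) (itvE a.2) => /= -> -> ->.
by rewrite -!EFinM !exprS expr0 mulr1 mulrA.
Qed.

Lemma boxes_cons c a s : boxes (c :: a) s = cbox (c : R3 R) s `|` boxes a s.
Proof.
apply/seteqP; split=> z.
  move=> [b]; rewrite inE => /orP[/eqP->|ba] h; first by left.
  by right; exists b.
move=> [h|[b ba h]]; first by exists c; rewrite ?mem_head.
by exists b; rewrite // inE ba orbT.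
Qed.

Lemma measurable_boxes a s : measurable (boxes a s).
Proof.
elim: a => [|c a IH]; last by rewrite boxes_cons; apply: measurableU => //;
  exact: measurable_cbox.
by rewrite (_ : boxes _ _ = set0)//; apply/seteqP; split=> z // [].
Qed.

Lemma vol_boxes a s : 0 <= s -> (vol (boxes a s) <= ((size a)%:R * s ^+ 3)%:E)%E.
Proof.
move=> s0; elim: a => [|c a IH].
  rewrite (_ : boxes _ _ = set0) ?measure0 ?mul0r//.
  by apply/seteqP; split=> z // [].
rewrite boxes_cons; apply: le_trans (measureU2 _ _ _) _.
- exact: measurable_cbox.
- exact: measurable_boxes.
rewrite /= -natr1 mulrDl mul1r addrC EFinD leeD//.
by have := vol_cbox c s0; rewrite /= => ->.
Qed.

Lemma lebesgue3_boxes a s (B : set (R3 R)) : 0 <= s ->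
  measurable (B : set (R * R * R)%type) ->
  (lebesgue3 (B `&` boxes a s) <= ((size a)%:R * s ^+ 3)%:E)%E.
Proof.
move=> s0 mB; apply: le_trans (vol_boxes a s0).
rewrite /lebesgue3; apply: le_measure; rewrite ?inE.
- by apply: measurableI => //; exact: measurable_boxes.
- exact: measurable_boxes.
- exact: subIsetr.
Qed.

End Boxes.

Lemma dopen_boxesC (R : realType) (T : Type) (dd : T -> T -> \bar R) (f : T ->
  R3 R)
    (a : seq (R * R * R)%type) s :
  (forall x y i, (`|coord (f x) i - coord (f y) i|)%:E <= dd x y)%E ->
  dopen dd (f @^-1` ~` boxes a s).
Proof.
move=> lip; elim: a => [|c a IH].
  rewrite (_ : _ @^-1` _ = setT); first exact: dopenT.
  by apply/seteqP; split=> // x _ [].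
rewrite boxes_cons setCU preimage_setI; apply: dopenI => //.
move=> x /= /existsNP[i /negP]; rewrite negb_and -!ltNge => h.
exists (Num.max (coord (c : R3 R) i - coord (f x) i)
    (coord (f x) i - (coord (c : R3 R) i + s))).
  by rewrite lt_max !subr_gt0.
move=> y xy cy; have := cy i; have := le_lt_trans (lip x y i) xy.
rewrite lte_fin lt_max !ltr_norml; lra.
Qed.

(** * Almost every point lies over infinitely many gates *)

Lemma step_gates_cases (R : realType) (M : nat) (first : bool) (S : stage R) G :
  @step_gates R M first S G ->
  @new_gates R M first S G \/ first = false /\ @old_gates R M first S G.
Proof. by rewrite /step_gates; case: first G => G; [left|case; [left|right]]. Qed.

Section Avoidance.
Variables (R : realType) (n0 : nat) (N : nat -> nat).
Hypothesis hn0 : (100 <= n0)%N.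
Hypothesis hN3 : forall n, (26 <= n)%N -> (3 %| 2 * N n + 1)%N.
Hypothesis hN : forall n, (26 <= n)%N ->
  1 / (2 * N n + 1)%:R \in `[1 / (128 * n)%:R, (1 / (32 * n)%:R : R)].
Local Notation X := (X R n0 N).
Local Notation Xinf := (Xinf R n0 N).
Local Notation stage_n := (stage_n n0).
Local Notation subdiv := (subdiv n0 N).
Local Notation cX := (cubical_X hn0 hN3 hN).
Local Notation R3 := (R * R * R)%type.

Variable k0 : nat.
Local Notation l0 := (nbar n0 k0).

Definition index3 l : finType :=
  ('I_(subdiv l) * 'I_(subdiv l) * 'I_(subdiv l))%type.

Definition is_middle l (ijk : index3 l) : bool :=
  [&& ijk.1.1 == N (stage_n l) :> nat, ijk.1.2 == N (stage_n l) :> nat &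
    ijk.2 == N (stage_n l) :> nat].

Definition kept_indices l : seq (index3 l) :=
  [seq ijk <- enum (index3 l) | ~~ ((l0 <= l)%N && is_middle ijk)].

Definition index_corner l (a : R3) (ijk : index3 l) : R3 :=
  shift a (slen (X l.+1)) ijk.1.1%:R ijk.1.2%:R ijk.2%:R.

(** The corners of the cubes of side slen (X l) that remain when, from the level
    l0 on, the central subcube of every cube is removed. Colours do not occur
    because both gates of a cell lie over the same subcube. *)
Fixpoint kept_corners l : seq R3 :=
  if l is l'.+1 then
    [seq index_corner a ijk | a <- kept_corners l', ijk <- kept_indices l']
  else [:: (0, 0, 0)].

Lemma subdiv_gt0 l : (0 < subdiv l)%N. Proof. by rewrite /subdiv addn1. Qed.

Lemma middle_lt l : (N (stage_n l) < subdiv l)%N.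
Proof. rewrite /subdiv; lia. Qed.

Lemma size_kept_indices l : (size (kept_indices l) <= subdiv l ^ 3 - (l0 <= l))%N.
Proof.
have cardT : size (enum (index3 l)) = (subdiv l ^ 3)%N.
  by rewrite -cardE !card_prod !card_ord !expnS expn0 muln1 mulnA.
rewrite size_filter; have [ll|_] := leqP l0 l;
  last by rewrite subn0 -cardT count_size.
have mid : (0 < count (@is_middle l) (enum (index3 l)))%N.
  rewrite -has_count; pose c := Ordinal (middle_lt l).
  by apply/hasP; exists (c, c, c); rewrite ?mem_enum// /is_middle /= eqxx.
rewrite (@eq_count _ _ (predC (@is_middle l))) => [|x //].
have := count_predC (@is_middle l) (enum (index3 l)); rewrite cardT.
by move: mid; move: (count _ _) (count _ _) (_ ^ 3)%N => ? ? ?; lia.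
Qed.

(** The level l0 is the beginning of a phase. *)
Definition avoiding (p : Xinf) := forall l, (l0 <= l)%N -> ~ in_gate l p.

(** Within a phase, a gate of X_(l+1) is either new, hence avoided, or contained
    in a gate of X_l. At the beginning of a phase all cells are doubled,
    whatever the gates are. *)
Lemma avoiding_gates p l : avoiding p -> (l0 <= l)%N ->
  first_step n0 l \/ forall G, @gates _ (X l) G -> ~ body G (prj_inf l p).
Proof.
move=> av; elim: l => [|l IH] ll.
  left; rewrite /first_step eq_sym -leqn0.
  by have /andP[] := levelP 0 (n0_gt0 hn0).
case: (ltngtP l0 l.+1) ll => // [l0l _|l0l _]; last first.
  left; rewrite /first_step -l0l (level_phase hn0 (k := k0))// leqnn/=.
  rewrite /nbar [leqRHS]big_nat_recr//= -addn1 leq_add2l expn_gt0.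
  by rewrite /nk addn_gt0 (n0_gt0 hn0).
right=> G GG Gp; rewrite ltnS in l0l.
have new : @new_gates R (N (stage_n l)) (first_step n0 l) (X l) G -> False.
  by move=> [c [Q [dQ EG]]]; apply: (av l l0l); exists c, Q; split=> //;
    rewrite -EG.
have [/new//|[nf [_ [G' GG' sub]]]] := step_gates_cases GG.
have [fl|notin] := IH l0l; first by rewrite /first_step nf in fl.
by apply: (notin G' GG'); have := sub _ Gp; rewrite /preimage /= prj_infS.
Qed.

(** A cell that contains an avoiding point is not a gate, hence is doubled at this
    step, and the point then avoids its central subcell. *)
Lemma avoiding_corner p l : avoiding p ->
  forall Q : cell R (X l), @cells _ (X l) Q ->
  body Q (prj_inf l p) -> (corner Q : R3) \in kept_corners l.
Proof.
move=> av; elim: l => [|l IH] Q cQ Qp; first by rewrite cQ mem_seq1.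
have [c [Q' [i [j [k [cQ' EQ]]]]]] := cQ; subst Q.
have [Q'p _ _] := Qp; rewrite prj_infS in Q'p.
apply/allpairsP; exists (corner Q' : R3, (i, j, k)); split=> //=; first exact: IH.
rewrite mem_filter mem_enum andbT;
  apply/negP => /andP[ll /and3P[/= /eqP Ei /eqP Ej /eqP Ek]].
apply: (av l ll); exists c, Q'; split; last first.
  by move: Qp; rewrite /= Ei Ej Ek.
rewrite /to_double; case: ifP => // nf; split=> // GQ.
have [fl|notin] := avoiding_gates av ll; last exact: notin GQ Q'p.
by rewrite fl in nf.
Qed.

Lemma avoiding_boxes p l : avoiding p ->
  boxes (kept_corners l) (slen (X l)) (pos (prj_inf l p)).
Proof.
move=> av; have [Q cQ Qp] := cell_cover (cX l) (prj_inf l p).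
exists (corner Q); first exact: (avoiding_corner av cQ Qp).
exact: (cell_pos (cX l) cQ Qp).
Qed.

Lemma pos_prj_inf (p : Xinf) l : pos (prj_inf l p) = sval (prj_inf 0 p).
Proof.
by elim: l => // l <-; rewrite -(prj_infS l p).
Qed.

Definition kept_volume l : R := (size (kept_corners l))%:R * slen (X l) ^+ 3.

Definition gate_mass l : R := \sum_(l0 <= i < l) (subdiv i)%:R ^- 3.

Lemma gate_mass_ge0 l : 0 <= gate_mass l.
Proof. by apply: sumr_ge0 => i _; rewrite invr_ge0 exprn_ge0. Qed.

Lemma kept_volume_ge0 l : 0 <= kept_volume l.
Proof. by rewrite mulr_ge0// exprn_ge0// ltW// (slen_X_gt0 hn0 hN3 hN). Qed.

Lemma kept_volumeS l :
  kept_volume l.+1 <= kept_volume l * (1 - (l0 <= l)%:R * (subdiv l)%:R ^- 3).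
Proof.
have M0 : 0 < (subdiv l)%:R :> R by rewrite ltr0n subdiv_gt0.
have sizeE : size (kept_corners l.+1) =
    (size (kept_corners l) * size (kept_indices l))%N.
  by rewrite /= size_allpairs.
rewrite /kept_volume (slen_X R n0 N l) sizeE natrM.
have := slen_X_gt0 hn0 hN3 hN l.+1; move: (slen (X l.+1)) => t t0.
rewrite exprMn -[leLHS]mulrA -[leRHS]mulrA ler_wpM2l//.
rewrite [leRHS](_ : _ = ((subdiv l)%:R ^+ 3 - (l0 <= l)%:R) * t ^+ 3); last first.
  by field; rewrite gt_eqF.
rewrite ler_wpM2r ?exprn_ge0 ?(ltW t0)//.
rewrite -natrX -natrB; last by case: (l0 <= l)%N => //=;
  rewrite expn_gt0 subdiv_gt0.
by rewrite ler_nat size_kept_indices.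
Qed.

(** With x the inverse of (subdiv l)^3, a step multiplies the volume by 1 - x and
    adds x to the mass S, and (1 - x) * (1 + S + x) <= 1 + S. The divergence of
    the series of the x is then enough for the volume to tend to 0. *)
Lemma kept_volume_le l : kept_volume l * (1 + gate_mass l) <= 1.
Proof.
elim: l => [|l IH].
  by rewrite /kept_volume /gate_mass big_geq//= expr1n addr0 !mulr1.
have v0 := kept_volume_ge0 l; have S0 := gate_mass_ge0 l.
have := kept_volumeS l; have [ll|ll] := leqP l0 l.
  rewrite /gate_mass big_nat_recr//= -/(gate_mass l) mul1r.
  have : 0 <= (subdiv l)%:R ^- 3 :> R by rewrite invr_ge0 exprn_ge0.
  move: (_ ^- 3) => x x0 hv; apply: le_trans IH.
  apply: (@le_trans _ _ (kept_volume l * (1 - x) * (1 + (gate_mass l + x)))).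
    by rewrite ler_wpM2r// addr_ge0// addr_ge0.
  rewrite -mulrA ler_wpM2l//.
  have := mulr_ge0 x0 S0; have := mulr_ge0 x0 x0; lra.
rewrite mul0r subr0 mulr1 => hv; apply: le_trans IH.
by rewrite /gate_mass !big_geq ?(ltnW ll)// ler_wpM2r// addr0.
Qed.

(** A phase with parameter n consists of n^3 steps, each of which contributes at
    least (128 * n)^-3. *)
Lemma gate_mass_ge k : k%:R / 128 ^+ 3 <= gate_mass (nbar n0 (k0 + k)).
Proof.
elim: k => [|k IH]; first by rewrite mul0r gate_mass_ge0.
have mono : (nbar n0 (k0 + k) <= nbar n0 (k0 + k.+1))%N by apply: nbar_mono;
  rewrite leq_add2l.
rewrite /gate_mass (big_cat_nat (n := nbar n0 (k0 + k)))//=;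
  last by apply: nbar_mono; rewrite leq_addr.
rewrite -natr1 mulrDl lerD//.
set n := nk n0 (k0 + k).+1.
have n_gt0 : 0 < n%:R :> R by rewrite ltr0n /n /nk addnS.
apply: (@le_trans _ _ (\sum_(nbar n0 (k0 + k) <=
  i < nbar n0 (k0 + k.+1)) (128 * n)%:R ^- 3)).
  rewrite sumr_const_nat addnS.
  rewrite [X in (X - _)%N](_ : _ = (nbar n0 (k0 + k) + n ^ 3)%N);
    last by rewrite /nbar big_nat_recr.
  rewrite addKn -[X in _ <= X]mulr_natr natrX natrM exprMn le_eqVlt; apply/orP;
    left; apply/eqP.
  by field; rewrite gt_eqF.
apply: ler_sum_nat => i hi;
  rewrite lef_pV2 ?posrE ?exprn_gt0 ?ltr0n ?subdiv_gt0//; last first.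
  by rewrite muln_gt0 /=; move: n_gt0; rewrite ltr0n.
rewrite lerXn2r ?nnegrE// ler_nat.
have := subdiv_le hn0 hN i; rewrite /stage_n.
by rewrite (level_phase hn0 (k := (k0 + k)%N))// -addnS.
Qed.

Lemma kept_volume_small e : 0 < e -> exists l, kept_volume l <= e.
Proof.
move=> e0; pose k := (Num.truncn (128 ^+ 3 / e)).+1.
exists (nbar n0 (k0 + k)); set l := nbar _ _.
have h : 1 / e <= gate_mass l.
  apply: le_trans (gate_mass_ge k); rewrite ler_pdivlMr ?exprn_gt0// mulrAC mul1r.
  by apply: ltW; exact: truncnS_gt.
suff : kept_volume l * (1 / e) <= 1 by rewrite mulrA mulr1 ler_pdivrMr// mul1r.
apply: le_trans (kept_volume_le l); rewrite ler_wpM2l ?kept_volume_ge0//; lra.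
Qed.

Variable mu_inf : probability (borel Xinf) R.
Hypothesis mu_inf_proj : forall (l : nat) (A : set (X l)),
     <<s dopen (@dist R (X l)) >> A ->
     mu_inf (@prj_inf R n0 N l @^-1` A) = mu A.

Definition kept_set l : set (X 0) :=
  [set x | boxes (kept_corners l) (slen (X l)) (sval x)].

(** At each level l the avoiding points project into the kept cubes, and
    [mu_inf_proj] at level 0 turns the volume of these into a bound for the
    measure. *)
Lemma avoiding_negligible : mu_inf.-negligible (avoiding : set (borel Xinf)).
Proof.
have lip0 (x y : X 0) i :
  ((`|coord (sval x) i - coord (sval y) i|)%:E <= dist x y)%E.
  exact: (pos_lip (cX 0) x y i).
have mA l : <<s dopen (@dist R (X 0)) >> (kept_set l).
  rewrite -[kept_set l]setCK -setTD.
  apply: sigma_algebraCD; apply: sub_sigma_algebra.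
  exact: dopen_boxesC.
have mB l : measurable (prj_inf 0 @^-1` kept_set l : set (borel Xinf)).
  rewrite -[_ @^-1` _]setCK; apply: measurableC; apply: sub_sigma_algebra.
  apply: (dopen_boxesC (f := fun x : Xinf => sval (prj_inf 0 x))) => x y i.
  by apply: le_trans (level_dist_le_dinf hn0 hN3 hN 0 x y); exact: lip0.
have muB l : (mu_inf (prj_inf 0 @^-1` kept_set l) <= (kept_volume l)%:E)%E.
  rewrite mu_inf_proj//.
  rewrite [leLHS](_ : _ = lebesgue3
    (@unit_cube R `&` boxes (kept_corners l) (slen (X l)))).
    apply: lebesgue3_boxes; first by rewrite ltW// (slen_X_gt0 hn0 hN3 hN).
    exact: measurable_cbox.
  rewrite /=; congr lebesgue3; apply/seteqP; split=> z.
    by move=> [x kx <-]; split=> //; exact: (svalP x).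
  by move=> [uz kz]; exists (exist _ z uz).
exists (\bigcap_l (prj_inf 0 @^-1` kept_set l)); split.
- exact: bigcapT_measurable.
- apply/eqP; rewrite eq_le measure_ge0 andbT; apply/lee_addgt0Pr => e e0;
    rewrite add0e.
  have [l le] := kept_volume_small e0.
  apply: le_trans (_ : _ <= mu_inf (prj_inf 0 @^-1` kept_set l))%E _.
    apply: le_measure; rewrite ?inE//; first exact: bigcapT_measurable.
    exact: bigcap_inf.
  by apply: le_trans (muB l) _; rewrite lee_fin.
- move=> p av l _; rewrite /kept_set /= -(pos_prj_inf p l).
  exact: avoiding_boxes.
Qed.

End Avoidance.

Theorem theorem3p57 (R : realType) (n0 : nat) (N : nat -> nat)
  (hn0 : (100 <= n0)%N)
  (hN3 : forall n, (26 <= n)%N -> (3 %| 2 * N n + 1)%N)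
  (hN : forall n, (26 <= n)%N ->
     1 / (2 * N n + 1)%:R \in `[1 / (128 * n)%:R, (1 / (32 * n)%:R : R)])
  (mu_inf : probability (borel (Xinf R n0 N)) R)
  (mu_inf_radon : radon mu_inf)
  (mu_inf_proj : forall (l : nat) (A : set (X R n0 N l)),
     <<s dopen (@dist R (X R n0 N l)) >> A ->
     mu_inf (@prj_inf R n0 N l @^-1` A) = mu A) :
  {ae mu_inf, forall p : Xinf R n0 N,
     exists (Y : metricType R) (q : Y),
       tangent (@dinf R n0 N) p q /\ ~ connected [set: Y]}.
Proof.
have avoiding_null : mu_inf.-negligible
    (\bigcup_k (@avoiding R n0 N k : set (borel (Xinf R n0 N)))).
  apply: negligible_bigcup => k.
  exact: (avoiding_negligible hn0 hN3 hN k mu_inf_proj).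
apply: negligibleS avoiding_null => p noTangent.
apply: contrapT => inGates; apply: noTangent.
apply: (gates_disconnected_tangent hn0 hN3 hN) => L.
apply: contrapT => noGate; apply: inGates; exists L => // l Ll gl.
apply: noGate; exists l => //.
exact: leq_trans (leq_nbar L (n0_gt0 hn0)) Ll.
Qed.
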